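(* Let $n\ge3$, $1<p\le2$, and $\lambda\in\mathbb R$ satisfy either (i) $p<\frac{n+2}{n-2}$ and $\lambda<\frac{(n-1)^2}{4}$, or (ii) $n\ge4$, $p=\frac{n+2}{n-2}$ and $\frac{n(n-2)}{4}<\lambda<\frac{(n-1)^2}{4}$. Fix $\varepsilon\in(0,1)$. For $R\in(0,1)$ let $U=\mathcal U[-Re_1]$, $V=\mathcal U[Re_1]$, and let $\Psi=\Psi_R\in H^1(\mathbb B^n)$ solve $$-\Delta_{\mathbb B^n}\Psi-\lambda\Psi=\mu\,(U+V)^{p-1}\Psi$$ with $\mu<\frac{p}{1-\varepsilon}$, normalized by $\int_{\mathbb B^n}\Psi^2(U+V)^{p-1}dv=1$. Then there exists a small $\alpha>0$ such that $$\int_{\mathbb B^n}\frac{\Psi^2}{(U+V)^{2\alpha}}\,dv$$ stays bounded, uniformly in $R$, as $R\to1$.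
   Context: $\mathbb B^n$ is the Poincaré ball model of hyperbolic $n$-space: the Euclidean unit ball with metric $\left(\frac{2}{1-|x|^2}\right)^2dx^2$, Laplace-Beltrami operator $\Delta_{\mathbb B^n}$, volume element $dv$ and distance $d(\cdot,\cdot)$. $H^1(\mathbb B^n)$ is the completion of $C_c^\infty(\mathbb B^n)$ with respect to the $L^2$ norm of the hyperbolic gradient. Under the stated conditions on $n,p,\lambda$, $\mathcal U\in H^1(\mathbb B^n)$ denotes the unique positive, radially symmetric (and decreasing) solution of $-\Delta_{\mathbb B^n}\mathcal U-\lambda\,\mathcal U=\mathcal U^p$. Viewing $\mathcal U$ as a function of $d(x,0)$, $\mathcal U[z](x)=\mathcal U(d(x,z))$ for $z\in\mathbb B^n$. $e_1=(1,0,\dots,0)$. It may be taken as known that $\mathcal U[z](x)$ is bounded above and below by positive constants (depending on $n,p,\lambda$) times $e^{-c(n,\lambda)d(x,z)}$ with $c(n,\lambda)=\frac{n-1+\sqrt{(n-1)^2-4\lambda}}{2}$. *)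

(* Defs.v *)
From HB Require Import structures.
From mathcomp Require Import all_boot all_order all_algebra.
From mathcomp Require Import all_classical all_reals all_analysis.

Set Implicit Arguments.
Unset Strict Implicit.
Unset Printing Implicit Defensive.

Import Order.TTheory GRing.Theory Num.Theory.
Import numFieldNormedType.Exports.

Local Open Scope classical_set_scope.
Local Open Scope ring_scope.

(* 'rV[R]_n carries the sigma-algebra generated by the coordinate maps, i.e.
   the Borel sets of R^n; this mirrors the library's instance on n.-tuple T. *)
Definition rV_display : measure_display -> measure_display.
Proof. exact. Qed.

Section measurable_rV.
Context d (T : measurableType d) (n : nat).

Let coor : 'I_n -> 'rV[T]_n -> T := fun i x => x ord0 i.

Let rV_set0 : g_sigma_preimage coor set0.
Proof. exact: sigma_algebra0. Qed.

Let rV_setC A : g_sigma_preimage coor A -> g_sigma_preimage coor (~` A).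
Proof. exact: sigma_algebraC. Qed.

Let rV_bigcup (F : _^nat) : (forall i, g_sigma_preimage coor (F i)) ->
  g_sigma_preimage coor (\bigcup_i (F i)).
Proof. exact: sigma_algebra_bigcup. Qed.

HB.instance Definition _ := @isMeasurable.Build (rV_display d)
  'rV[T]_n (g_sigma_preimage coor) rV_set0 rV_setC rV_bigcup.

End measurable_rV.

Section measurable_rV_theory.
Context d (T : measurableType d) d' (S : measurableType d') (n : nat).

Lemma measurable_coord (i : 'I_n) :
  measurable_fun [set: 'rV[T]_n] (fun x : 'rV[T]_n => x ord0 i).
Proof.
move=> _ Y mY; rewrite setTI; apply: sub_sigma_algebra => /=.
rewrite -bigcup_seq/=; exists i => /=; first by rewrite mem_index_enum.
by exists Y => //; rewrite setTI.
Qed.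

Lemma measurable_fun_rVP (f : S -> 'rV[T]_n) :
  measurable_fun [set: S] f <->
  forall i, measurable_fun [set: S] (fun x => f x ord0 i).
Proof.
split=> [mf i|mf].
  exact: (measurableT_comp (measurable_coord i) mf).
move=> _ A mA; rewrite setTI; move: A mA.
suff : (measurable : set (set 'rV[T]_n)) `<=` [set A | measurable (f @^-1` A)].
  exact.
apply: smallest_sub.
  split => [|A|F mF] /=.
  - by rewrite preimage_set0.
  - by rewrite setTD preimage_setC; exact: measurableC.
  - by rewrite preimage_bigcup; apply: bigcupT_measurable.
rewrite -bigcup_seq/=; apply: bigcup_sub => i _ _ [B mB <-] /=.
by have := mf i measurableT B mB; rewrite !setTI.
Qed.

End measurable_rV_theory.

(* Lebesgue measure on R^n, as an iterated product of the library's Lebesgue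
   measure on R. *)
Section lebesgue_rV.
Context (R : realType).
Local Notation mR := (measurableTypeR R).

Definition uncons_rV n (x : 'rV[mR]_n.+1) : mR * 'rV[mR]_n :=
  (x ord0 ord0, \row_j x ord0 (lift ord0 j)).

Definition cons_rV n (p : mR * 'rV[mR]_n) : 'rV[mR]_n.+1 :=
  row_mx (const_mx p.1 : 'rV[mR]_1) p.2.

Lemma measurable_cons_rV n : measurable_fun [set: mR * 'rV[mR]_n] (@cons_rV n).
Proof.
apply/measurable_fun_rVP => i; case: (split_ordP (i : 'I_(1 + n))) => j ->.
  rewrite (_ : (fun _ => _) = fst); first exact: measurable_fst.
  by apply/funext => p; etransitivity; [exact: row_mxEl|rewrite mxE].
rewrite (_ : (fun _ => _) = (fun x : 'rV[mR]_n => x ord0 j) \o snd).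
  by apply: measurableT_comp; [exact: measurable_coord|exact: measurable_snd].
by apply/funext => p; exact: row_mxEr.
Qed.

Lemma measurable_uncons_rV n : measurable_fun setT (@uncons_rV n).
Proof.
apply: measurable_fun_pair; first exact: measurable_coord.
apply/measurable_fun_rVP => j; under eq_fun do rewrite mxE.
exact: measurable_coord.
Qed.

Lemma cons_rVK n : cancel (@cons_rV n) (@uncons_rV n).
Proof.
move=> [a v]; rewrite /uncons_rV /cons_rV /=; congr pair.
  rewrite (_ : ord0 = lshift n (ord0 : 'I_1)); last exact: val_inj.
  by etransitivity; [exact: row_mxEl|rewrite mxE].
apply/rowP => j; rewrite mxE.
rewrite (_ : lift ord0 j = rshift 1 j); last exact: val_inj.
exact: row_mxEr.
Qed.

Section succ.
Context n (m : {sigma_finite_measure set 'rV[mR]_n -> \bar R}).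

Definition lebesgue_rV_succ : set 'rV[mR]_n.+1 -> \bar R :=
  pushforward (@lebesgue_measure R \x m)%E (@cons_rV n).

Let succ0 : lebesgue_rV_succ set0 = 0%E.
Proof. by rewrite /lebesgue_rV_succ /pushforward preimage_set0 measure0. Qed.

Let succ_ge0 A : (0 <= lebesgue_rV_succ A)%E.
Proof. by rewrite /lebesgue_rV_succ /pushforward; exact: measure_ge0. Qed.

Let succ_sigma_additive : semi_sigma_additive lebesgue_rV_succ.
Proof.
move=> F mF tF mUF; rewrite /lebesgue_rV_succ /pushforward preimage_bigcup.
have mcF k : measurable (@cons_rV n @^-1` F k).
  by rewrite -[X in measurable X]setTI; exact: measurable_cons_rV.
apply: measure_semi_sigma_additive => //.
  apply/trivIsetP => i j _ _ ij; rewrite -preimage_setI.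
  by move/trivIsetP : tF => /(_ i j Logic.I Logic.I ij) ->; rewrite preimage_set0.
exact: bigcupT_measurable.
Qed.

HB.instance Definition _ := isMeasure.Build _ _ _ lebesgue_rV_succ
  succ0 succ_ge0 succ_sigma_additive.

Let succ_sigma_finite : sigma_finite setT lebesgue_rV_succ.
Proof.
have /sigma_finiteP[F [FT ndF Foo]] := sigma_finiteT (@lebesgue_measure R).
have /sigma_finiteP[G [GT ndG Goo]] := sigma_finiteT m.
exists (fun k => @uncons_rV n @^-1` (F k `*` G k)).
  rewrite -preimage_bigcup -[LHS](preimage_setT (@uncons_rV n)); congr (_ @^-1` _).
  rewrite -setXTT FT GT predeqE => -[x y]; split.
    move=> [/= [i _ Fix] [j _ Gjy]]; exists (maxn i j) => //; split.
    - by move: x Fix; exact/subsetPset/ndF/leq_maxl.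
    - by move: y Gjy; exact/subsetPset/ndG/leq_maxr.
  by move=> [k _ []/= ? ?]; split; exists k.
move=> k; have [mF lF] := Foo k; have [mG lG] := Goo k; split.
  rewrite -[X in measurable X]setTI; apply: measurable_uncons_rV => //.
  exact: measurableX.
rewrite /lebesgue_rV_succ /pushforward -comp_preimage.
rewrite (_ : _ \o _ = id); last by apply/funext => p; exact: cons_rVK.
by rewrite preimage_id product_measure1E// lte_mul_pinfty// ge0_fin_numE.
Qed.

HB.instance Definition _ := Measure_isSigmaFinite.Build _ _ _ lebesgue_rV_succ
  succ_sigma_finite.

End succ.

Fixpoint lebesgue_rV n : {sigma_finite_measure set 'rV[mR]_n -> \bar R} :=
  match n with
  | 0 => \d_(0 : 'rV[mR]_0)
  | n'.+1 => lebesgue_rV_succ (lebesgue_rV n')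
  end.

Lemma lebesgue_rV_box n (A : 'I_n -> set mR) : (forall i, measurable (A i)) ->
  lebesgue_rV n [set x | forall i, A i (x ord0 i)] =
  (\prod_(i < n) @lebesgue_measure R (A i))%E.
Proof.
elim: n A => [|n IHn] A mA.
  by rewrite big_ord0 /= diracE mem_set // => -[].
pose B := [set x : 'rV[mR]_n | forall i, A (lift ord0 i) (x ord0 i)].
have mB : measurable B.
  rewrite (_ : B = \bigcap_(i in [set: 'I_n])
      ((fun x : 'rV[mR]_n => x ord0 i) @^-1` A (lift ord0 i))); last first.
    by apply/seteqP; split => x /= h; [move=> i _; exact: h|move=> i; exact: h].
  apply: fin_bigcap_measurable => // i _; rewrite -[X in measurable X]setTI.
  exact: measurable_coord.
rewrite big_ord_recl -IHn//= -/B -product_measure1E//.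
rewrite /lebesgue_rV_succ /pushforward; congr (_ _).
have cons0 p : @cons_rV n p ord0 ord0 = p.1.
  by have /(congr1 fst) := cons_rVK p.
have consS p i : @cons_rV n p ord0 (lift ord0 i) = p.2 ord0 i.
  by have /(congr1 snd)/rowP/(_ i) := cons_rVK p; rewrite mxE.
apply/seteqP; split => -[a v] /= h.
  by split => [|i]; [have := h ord0; rewrite cons0|have := h (lift ord0 i); rewrite consS].
case: h => ha hv i; case: (unliftP ord0 i) => [j ->|->].
  by rewrite consS; exact: hv.
by rewrite cons0.
Qed.

End lebesgue_rV.

Section hyperbolic_ball.
Context (R : realType) (n : nat).
Implicit Types (x y z : 'rV[R]_n) (f phi Psi : 'rV[R]_n -> R).

Definition dotr x y : R := \sum_(i < n) x ord0 i * y ord0 i.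

(* The norm `|x| of 'rV[R]_n is the sup norm, hence this squared Euclidean one. *)
Definition sqn x : R := dotr x x.

Definition poincare_ball : set 'rV[R]_n := [set x | sqn x < 1].

(* The metric is (conformal x)^2 dx^2. *)
Definition conformal x : R := 2 / (1 - sqn x).

(* The geodesic distance: cosh d(x,y) = 1 + 2|x-y|^2 / ((1-|x|^2)(1-|y|^2)). *)
Definition arcosh (t : R) : R := ln (t + Num.sqrt (t ^+ 2 - 1)).

Definition hdist x y : R :=
  arcosh (1 + 2 * sqn (x - y) / ((1 - sqn x) * (1 - sqn y))).

(* Integral over the ball against dv = (conformal x)^n dx. *)
Definition hintegral f : \bar R :=
  \int[lebesgue_rV R n]_(x in poincare_ball) (f x * conformal x ^+ n)%:E.

Definition partial (i : 'I_n) f x : R := 'D_(delta_mx ord0 i) f x.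

Definition gradient f x : 'rV[R]_n := \row_(i < n) partial i f x.

(* Inner product, in the hyperbolic metric, of the hyperbolic gradients
   (conformal x)^-2 v and (conformal x)^-2 w, where v and w are the Euclidean
   gradients at x. *)
Definition hgrad_dot x (v w : 'rV[R]_n) : R := conformal x ^- 2 * dotr v w.

Fixpoint of_class_C (k : nat) f : Prop :=
  match k with
  | 0 => continuous f
  | k'.+1 => (forall x, differentiable f x) /\
             forall i, of_class_C k' (partial i f)
  end.

(* C_c^infty of the ball, its elements being extended by 0 to R^n. *)
Definition test_function phi : Prop :=
  [/\ forall k, of_class_C k phi,
      compact (closure [set x | phi x != 0]) &
      closure [set x | phi x != 0] `<=` poincare_ball].

(* Psi belongs to H^1 of the ball, with (Euclidean) weak gradient G. The
   completion of C_c^infty for the norm ||grad||_{L^2(dv)} is realised by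
   functions: a Cauchy sequence phi_k is one whose gradients converge in L^2 to
   some G, and it represents the a.e. limit Psi of the phi_k. (By the Poincare
   inequality phi_k then converges to Psi in L^2(dv) too.) *)
Definition H1_gradient Psi (G : 'rV[R]_n -> 'rV[R]_n) : Prop :=
  [/\ measurable_fun poincare_ball (Psi : 'rV[measurableTypeR R]_n -> R),
      measurable_fun poincare_ball
        (G : 'rV[measurableTypeR R]_n -> 'rV[measurableTypeR R]_n) &
      exists phi_ : nat -> 'rV[R]_n -> R,
      [/\ forall k, test_function (phi_ k),
          hintegral (fun x => hgrad_dot x (gradient (phi_ k) x - G x)
                                          (gradient (phi_ k) x - G x))
            @[k --> \oo] --> 0%E &
          {ae lebesgue_rV R n, forall x, poincare_ball x ->
            phi_ k x @[k --> \oo] --> Psi x}]].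

(* Psi is an H^1 solution of - Delta Psi - lambda Psi = f, where Delta is the
   Laplace-Beltrami operator, in the weak sense:
   int <grad Psi, grad phi> dv = - int Psi Delta phi dv for phi in C_c^infty. *)
Definition H1_solution (lambda : R) f Psi : Prop :=
  exists2 G, H1_gradient Psi G &
    forall phi, test_function phi ->
      hintegral (fun x => hgrad_dot x (G x) (gradient phi x)
                          - lambda * Psi x * phi x) =
      hintegral (fun x => f x * phi x).

(* The translate u(d(.,z)) of the radial function of profile u. *)
Definition translate (u : R -> R) z : 'rV[R]_n -> R := fun x => u (hdist x z).

(* u : [0, +oo[ -> R is the profile of the positive, radially symmetric and
   decreasing H^1 solution of - Delta U - lambda U = U^p. Continuity selects
   the (classical) representative of U in its a.e. class, since u is evaluated
   pointwise. *)
Definition ground_state (lambda p : R) (u : R -> R) : Prop :=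
  [/\ {within `[0, +oo[, continuous u},
      forall s, 0 <= s -> 0 < u s,
      forall s t, 0 <= s -> s < t -> u t < u s &
      H1_solution lambda (fun x => translate u 0 x `^ p) (translate u 0)].

(* The exact exponential decay rate of the ground state. *)
Definition decay_rate (lambda : R) : R :=
  (n%:R - 1 + Num.sqrt ((n%:R - 1) ^+ 2 - 4 * lambda)) / 2.

(* The point a e_1 (n is not of the form _.+1 here, hence the test on values). *)
Definition e1_axis (a : R) : 'rV[R]_n := \row_(i < n) (a *+ (i == 0 :> nat)).

End hyperbolic_ball.

(* Main.v *)
(* Agmon-type estimate. Put q_i = 1 / cosh d(x, z_i) with z_1, z_2 = -r e_1, r e_1,
   so that W = U + V is comparable to q_1^kappa + q_2^kappa, kappa being the decay
   rate. The weight w = (q_1^2 + q_2^2 + dl)^(-beta/2) is smooth and bounded, and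
   |grad w| <= beta w. Testing the equation against w^2 Psi gives
     int |grad (w Psi)|^2 - lambda w^2 Psi^2
       = int |grad w|^2 Psi^2 + mu int W^(p-1) w^2 Psi^2.
   The left-hand side is at least ((n-1)^2/4 - lambda) int w^2 Psi^2 by the Poincare
   inequality. Where W is small the potential term is absorbed; where W is bounded
   below, so is q_1^2 + q_2^2, hence w is bounded and the normalization of Psi
   applies. The resulting bound on int w^2 Psi^2 depends neither on r nor on dl, and
   dl -> 0 yields the claim with alpha = beta / kappa. *)
Require Import Defs.
From mathcomp Require Import all_boot all_order all_algebra.
From mathcomp Require Import all_classical all_reals all_analysis.
From mathcomp Require Import measurable_realfun ring lra.

Set Implicit Arguments.
Unset Strict Implicit.
Unset Printing Implicit Defensive.

Import Order.TTheory GRing.Theory Num.Theory.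
Import numFieldNormedType.Exports.

Local Open Scope classical_set_scope.
Local Open Scope ring_scope.

(** * Measurability on R^n *)

Section borel_rV.
Context (R : realType) (n : nat).
Local Notation mR := (measurableTypeR R).

(** An H^1 function is only a limit of test functions, so [w^2 Psi] cannot be inserted in the weak
    equation and the energy identity is never written for [Psi] itself. The equation is tested
    against [w^2 phi], where [phi] approximates [Psi]; Young's inequality with a small parameter [t]
    turns the defects [grad phi - G] and [phi - Psi] into error terms, at the price of factors
    [1 - t] and [1 + t].

    The error coefficients contain the bound [Cw] on [w^2], which blows up as [dl] tends to 0, and
    [|mu|], which is uncontrolled because [mu] is bounded only from above. This fixes the order of
    the limits: [phi] tends to [Psi] with [dl] and [mu] frozen, which removes both quantities, and
    only then [dl] tends to 0, by Fatou.

    The weight is built on 1 / cosh d and not on e^(-d): cosh d is smooth at the centre, d is not,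
    and the two differ by a factor of at most 2. The exponent [alpha] is small because the term
    [beta^2] coming from [grad w] has to fit into the gap (n-1)^2/4 - [lambda]. *)

Lemma open_measurable_rV (A : set 'rV[R]_n) :
  open A -> measurable (A : set 'rV[mR]_n).
Proof.
move=> oA.
(* An open set is the union of the boxes with rational centre and radius 1/(k+1) that it contains;
   [F] empties the other boxes, so that the union runs over a whole countable type. *)
pose B (qk : 'rV[rat]_n * nat) : set 'rV[R]_n := [set x : 'rV[R]_n |
  forall i, ball (ratr (qk.1 ord0 i) : R) (qk.2.+1%:R^-1) (x ord0 i)].
pose F qk := if `[< B qk `<=` A >] then B qk else set0.
have -> : A = \bigcup_qk F qk.
  apply/seteqP; split => [x Ax|x [qk _]]; last first.
    by rewrite /F; case: asboolP => // + Bx; exact.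
  have /nbhs_ballP[e /= e0 xeA] : nbhs x A by exact: open_nbhs_nbhs.
  have [k ke] : exists k : nat, k.+1%:R^-1 < e / 2.
    have [k _ /(_ k)] := near_infty_natSinv_lt (PosNum (divr_gt0 e0 (ltr0n R 2))).
    by move=> /(_ (leqnn k)) h; exists k.
  have /choice[q qP] : forall i : 'I_n,
      exists q : rat, ball (x ord0 i) (k.+1%:R^-1) (ratr q : R).
    move=> i; have /rat_in_itvoo[q qP] : x ord0 i - k.+1%:R^-1 < x ord0 i + k.+1%:R^-1.
      by rewrite ltrBlDr -addrA ltrDl addr_gt0// invr_gt0.
    by exists q; rewrite ball_itv/=.
  exists (\row_i q i, k) => //; rewrite /F; case: asboolP => [_|[]].
    by move=> i /=; rewrite mxE; apply: ball_sym; exact: qP.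
  move=> y By; apply: xeA; split => // i j; rewrite (ord1 i).
  have := By j; have := qP j; rewrite /= mxE -!ball_normE /ball_/= => xq qy.
  suff: `|x ord0 j - y ord0 j| < e by [].
  rewrite (le_lt_trans (ler_distD (ratr (q j)) _ _))// [e]splitr.
  by apply: ltrD; [exact: lt_trans xq ke|exact: lt_trans qy ke].
apply: countable_bigcupT_measurable => [|qk]; first exact: countableP.
rewrite /F; case: asboolP => // _.
rewrite (_ : B qk = \bigcap_(i in [set: 'I_n])
    ((fun x : 'rV[mR]_n => x ord0 i) @^-1` ball (ratr (qk.1 ord0 i) : R) (qk.2.+1%:R^-1))).
  apply: fin_bigcap_measurable => // i _; rewrite -[X in measurable X]setTI.
  by apply: measurable_coord => //; rewrite ball_itv; exact: measurable_itv.
by apply/seteqP; split => x /= h; [move=> i _; exact: h|move=> i; exact: h].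
Qed.

Lemma open_continuous_measurable_fun_rV (D : set 'rV[R]_n) (f : 'rV[R]_n -> R) :
  open D -> {in D, continuous f} -> measurable_fun D (f : 'rV[mR]_n -> mR).
Proof.
move=> oD cf _; apply: (measurability _ (RGenOpens.measurableE R)).
move=> _ [_ [a [b ->] <-]]; apply: open_measurable_rV.
by move/(continuous_inP f oD) : cf; apply; exact: interval_open.
exact: open_measurable_rV.
Qed.

Lemma continuous_measurable_fun_rV (f : 'rV[R]_n -> R) :
  continuous f -> measurable_fun setT (f : 'rV[mR]_n -> mR).
Proof.
by move=> cf; apply: open_continuous_measurable_fun_rV => //; exact: openT.
Qed.

End borel_rV.

(** * Integrals of derivatives of compactly supported functions *)

Section bounded_support.
Context (R : realType).
Local Notation mR := (measurableTypeR R).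

Definition cube n (M : R) : set 'rV[R]_n :=
  [set x | forall i, `[- M, M]%classic (x ord0 i)].
Arguments cube : clear implicits.

Lemma notin_cube n M (x : 'rV[R]_n) : ~ cube n M x -> exists i, M < `|x ord0 i|.
Proof.
move=> /existsNP[i]; exists i; rewrite ltNge; apply/negP => xM.
by apply: p; rewrite /= in_itv/= -ler_norml.
Qed.

Lemma compact_cube n M : compact (cube n M).
Proof.
by apply: (@rV_compact R n (fun=> `[- M, M]%classic)) => i; exact: segment_compact.
Qed.

Lemma measurable_cube n M : measurable (cube n M : set 'rV[mR]_n).
Proof.
rewrite (_ : cube n M = \bigcap_(i in [set: 'I_n])
    ((fun x : 'rV[mR]_n => x ord0 i) @^-1` `[- M, M]%classic)).
  apply: fin_bigcap_measurable => // i _; rewrite -[X in measurable X]setTI.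
  by apply: measurable_coord => //; exact: measurable_itv.
by apply/seteqP; split => x /= h; [move=> i _; exact: h|move=> i; exact: h].
Qed.

Lemma lebesgue_cube_lty n M : (lebesgue_rV R n (cube n M) < +oo)%E.
Proof.
rewrite /cube (@lebesgue_rV_box R n (fun=> `[- M, M]%classic)); last first.
  by move=> i; exact: measurable_itv.
rewrite ltey_eq prode_fin_num// => i _.
by rewrite lebesgue_measure_itv/=; case: ifP.
Qed.

Lemma continuous_compact_bounded (T : topologicalType) (K : set T) (f : T -> R) :
  compact K -> {within K, continuous f} ->
  exists2 C, 0 < C & forall x, K x -> `|f x| <= C.
Proof.
move=> cK cf; have /compact_bounded[C [_ CP]] := continuous_compact cf cK.
exists (`|C| + 1); first by rewrite ltr_wpDl.
by move=> x Kx; apply: CP; [rewrite ltr_pwDr// ler_norm|exists x].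
Qed.

Lemma continuous_bounded_support n (f : 'rV[R]_n -> R) (M : R) : continuous f ->
  (forall (x : 'rV[R]_n) (i : 'I_n), M < `|x ord0 i| -> f x = 0) ->
  exists2 C, 0 < C & forall x, `|f x| <= C.
Proof.
move=> cf f0.
have [C C0 CP] := continuous_compact_bounded (@compact_cube n M)
  (continuous_subspaceT cf).
exists C => // x; have [/CP//|/notin_cube[i /f0 ->]] := pselect (cube n M x).
by rewrite normr0 ltW.
Qed.

Lemma integrable_bounded_support d (T : measurableType d)
    (mu : {measure set T -> \bar R}) (D : set T) (f : T -> R) C :
  measurable D -> (mu D < +oo)%E -> measurable_fun setT f ->
  (forall x, `|f x| <= C) -> (forall x, ~ D x -> f x = 0) ->
  mu.-integrable setT (EFin \o f).
Proof.
move=> mD Doo mf fC f0.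
have : mu.-integrable D (EFin \o f).
  apply: measurable_bounded_integrable => //; first exact: measurable_funTS.
  exists C; split; first exact: num_real.
  by move=> M CM x _ /=; exact: le_trans (fC x) (ltW CM).
rewrite integrable_mkcond//; congr (_.-integrable _ _); apply/funext => x.
rewrite patchE; case: ifPn => //; rewrite notin_setE => /f0/= ->//.
Qed.

End bounded_support.
Arguments cube {R} n M.

Section divergence.
Context (R : realType).
Local Notation mR := (measurableTypeR R).

Lemma integral_derive1_eq0 (f : R -> R) (M : R) :
  (forall t : R, derivable f t 1) -> continuous (fun t => 'D_1 f t) ->
  (forall t : R, M < `|t| -> f t = 0) ->
  (\int[@lebesgue_measure R]_t ('D_1 f t)%:E = 0)%E.
Proof.
(* The radius exceeds both [M] and 0: [f] vanishes at both endpoints and the interval is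
   nondegenerate. *)
move=> df cf f0; pose N : R := `|M| + 1.
have N0 : 0 < N by rewrite ltr_wpDl.
have MN : M < N by rewrite ltr_pwDr// ler_norm.
have f'0 (t : R) : N < `|t| -> 'D_1 f t = 0.
  move=> Nt; rewrite -[RHS](derive_cst (0 : R) t 1); apply: near_eq_derive.
  have : \forall s \near t, N < `|s|.
    exact: (@cvgr_gt R R (nbhs t) _ Num.norm `|t| (@norm_continuous _ R^o t) N Nt).
  by apply: filterS => s Ns; rewrite f0//; exact: lt_trans Ns.
transitivity (\int[@lebesgue_measure R]_(t in `[(- N)%R, N]) ('D_1 f t)%:E)%E.
  rewrite [RHS]integral_mkcond; apply: eq_integral => t _; rewrite patchE.
  case: ifPn => //; rewrite notin_setE/= in_itv/= -ler_norml => /negP.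
  by rewrite -ltNge => /f'0 ->.
rewrite (@continuous_FTC2 _ _ f).
- by rewrite !f0 ?subee// ?normrN gtr0_norm.
- by rewrite -subr_gt0 opprK addr_gt0.
- exact: continuous_subspaceT.
- have cvf t : {for t, continuous f}.
    by apply: differentiable_continuous; exact/derivable1_diffP.
  split; first by move=> t _; exact: df.
    exact/cvg_at_right_filter/cvf.
  exact/cvg_at_left_filter/cvf.
- by move=> t _; rewrite derive1E.
Qed.

Lemma cons_rVE0 n (p : mR * 'rV[mR]_n) : cons_rV p ord0 ord0 = p.1.
Proof. by have /(congr1 fst) := cons_rVK p. Qed.

Lemma cons_rVES n (p : mR * 'rV[mR]_n) i : cons_rV p ord0 (lift ord0 i) = p.2 ord0 i.
Proof. by have /(congr1 snd)/rowP/(_ i) := cons_rVK p; rewrite mxE. Qed.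

Lemma rV_eq_cons n (x y : 'rV[R]_n.+1) : x ord0 ord0 = y ord0 ord0 ->
  (forall i, x ord0 (lift ord0 i) = y ord0 (lift ord0 i)) -> x = y.
Proof.
by move=> h0 hS; apply/rowP => i; case: (unliftP ord0 i) => [j ->|->].
Qed.

Lemma continuous_cons_rVr n (a : R) :
  continuous (fun v : 'rV[R]_n => cons_rV (a, v) : 'rV[R]_n.+1).
Proof.
move=> v A [P Pn PA]; exists (fun i j => P ord0 (lift ord0 j)).
  by move=> i j; have := Pn ord0 (lift ord0 j); rewrite cons_rVES (ord1 i).
move=> w wP; apply: PA => i j; rewrite (ord1 i); case: (unliftP ord0 j) => [k ->|->].
  by rewrite cons_rVES; have := wP ord0 k.
by rewrite cons_rVE0; apply: nbhs_singleton; have := Pn ord0 ord0; rewrite cons_rVE0.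
Qed.

Lemma continuous_cons_rVl n (v : 'rV[R]_n) :
  continuous (fun a : R => cons_rV (a, v) : 'rV[R]_n.+1).
Proof.
move=> a A [P Pn PA]; have := Pn ord0 ord0; rewrite cons_rVE0; apply: filterS => b Pb.
apply: PA => i j; rewrite (ord1 i); case: (unliftP ord0 j) => [k ->|->].
  rewrite cons_rVES; apply: nbhs_singleton.
  by have := Pn ord0 (lift ord0 k); rewrite cons_rVES.
by rewrite cons_rVE0.
Qed.

(** Fubini, with the differentiated variable innermost. If it is the first coordinate, the
    fundamental theorem of calculus applies on each line; otherwise freezing the first coordinate
    gives an instance of the induction hypothesis. Fubini is legitimate because a continuous
    function with bounded support is integrable. *)
Lemma integral_partial_eq0 n (i : 'I_n) (f : 'rV[R]_n -> R) (M : R) :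
  (forall x, derivable f x (delta_mx ord0 i)) -> continuous (partial i f) ->
  (forall (x : 'rV[R]_n) (j : 'I_n), M < `|x ord0 j| -> f x = 0) ->
  (\int[lebesgue_rV R n]_x (partial i f x)%:E = 0)%E.
Proof.
elim: n i f => [[]//|n IHn] i f df cf f0.
have g0 (x : 'rV[R]_n.+1) (j : 'I_n.+1) : M < `|x ord0 j| -> partial i f x = 0.
  move=> Mx; rewrite -[RHS](derive_cst (0 : R) x (delta_mx ord0 i)).
  apply: near_eq_derive.
  have : \forall y \near x, M < `|(y : 'rV[R]_n.+1) ord0 j|.
    apply: (@cvgr_gt R _ (nbhs x) _ (fun y => `|y ord0 j|) `|x ord0 j| _ M Mx).
    apply: (@cvg_norm _ R^o).
    exact: coord_continuous.
  by apply: filterS => y; exact: f0.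
have [C C0 gC] := continuous_bounded_support cf g0.
have mg : measurable_fun setT (partial i f : 'rV[mR]_n.+1 -> mR).
  exact: continuous_measurable_fun_rV.
pose P := (@lebesgue_measure R \x lebesgue_rV R n)%E.
pose g (p : mR * 'rV[mR]_n) := partial i f (cons_rV p).
have mc : measurable_fun setT (@cons_rV R n) := @measurable_cons_rV R n.
have ig : P.-integrable setT (EFin \o g).
  apply: (@integrable_bounded_support _ _ _ P (@cons_rV R n @^-1` cube n.+1 M) g C).
  - by rewrite -[X in measurable X]setTI; apply: mc => //; exact: measurable_cube.
  - exact: (lebesgue_cube_lty n.+1 M).
  - exact: measurableT_comp.
  - by move=> p; exact: gC.
  - by move=> p /notin_cube[j]; exact: g0.
transitivity (\int[P]_p (g p)%:E)%E.
  move/measurable_EFinP : mg => mEg.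
  exact: (integral_pushforward (D := setT) mc mEg ig measurableT).
case: (unliftP ord0 i) => [j ij|i0].
  rewrite -integral12_prod_meas1//; apply: integral0_eq => a _.
  pose s := fun v : 'rV[R]_n => f (cons_rV (a, v)).
  have sE h v : cons_rV (a, h *: delta_mx ord0 j + v) =
      h *: delta_mx ord0 i + cons_rV (a, v) :> 'rV[R]_n.+1.
    apply: rV_eq_cons => [|k]; rewrite [RHS]mxE ?cons_rVE0 ?cons_rVES/= !mxE.
      by rewrite ij eqxx /= mulr0 add0r.
    by rewrite ij (inj_eq lift_inj).
  (* The slice and [f] have the same difference quotients, so derivability and the value of the
     derivative transfer without a chain rule. *)
  have qE v : (fun h : R => h^-1 *: ((s \o shift v) (h *: delta_mx ord0 j) - s v)) =
      fun h => h^-1 *: ((f \o shift (cons_rV (a, v))) (h *: delta_mx ord0 i)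
                        - f (cons_rV (a, v))).
    by apply/funext => h /=; rewrite /s sE.
  have dE v : partial j s v = g (a, v) by rewrite /partial /g /partial /derive qE.
  transitivity (\int[lebesgue_rV R n]_v (partial j s v)%:E)%E.
    by apply: eq_integral => v _; rewrite dE.
  apply: IHn.
  - by move=> v; rewrite /derivable qE; exact: df.
  - rewrite (_ : partial j s = fun v => g (a, v)); last exact/funext.
    move=> v; apply: (@continuous_comp _ _ _ (fun v : 'rV[R]_n => cons_rV (a, v)) (partial i f)).
      exact: continuous_cons_rVr.
    exact: cf.
  - by move=> v k Mv; apply: (f0 _ (lift ord0 k)); rewrite cons_rVES.
rewrite -integral21_prod_meas1//; apply: integral0_eq => v _.
pose s := fun a : R => f (cons_rV (a, v)).
have sE h a : cons_rV (h *: 1 + a, v) =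
    h *: delta_mx ord0 i + cons_rV (a, v) :> 'rV[R]_n.+1.
  apply: rV_eq_cons => [|k]; rewrite [RHS]mxE ?cons_rVE0 ?cons_rVES/= !mxE.
    by rewrite i0 eqxx.
  by rewrite i0 /= mulr0 add0r.
have qE a : (fun h : R => h^-1 *: ((s \o shift a) (h *: 1) - s a)) =
    fun h => h^-1 *: ((f \o shift (cons_rV (a, v))) (h *: delta_mx ord0 i)
                      - f (cons_rV (a, v))).
  by apply/funext => h /=; rewrite /s sE.
have dE a : 'D_1 s a = g (a, v) by rewrite /g /partial /derive qE.
transitivity (\int[@lebesgue_measure R]_a ('D_1 s a)%:E)%E.
  by apply: eq_integral => a _; rewrite dE.
apply: (@integral_derive1_eq0 s M).
- by move=> a; rewrite /derivable qE; exact: df.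
- rewrite (_ : (fun t => 'D_1 s t) = fun a => g (a, v)); last exact/funext.
  move=> a; apply: (@continuous_comp _ _ _ (fun a : R => cons_rV (a, v)) (partial i f)).
    exact: continuous_cons_rVl.
  exact: cf.
- by move=> a Ma; apply: (f0 _ ord0); rewrite cons_rVE0.
Qed.

End divergence.

(** * Partial derivatives and smooth functions *)

Section partial_calculus.
Context (R : realType) (n : nat).
Implicit Types (f g : 'rV[R]_n -> R) (i : 'I_n) (x : 'rV[R]_n).

Lemma partialD i f g x : differentiable f x -> differentiable g x ->
  partial i (fun y => f y + g y) x = partial i f x + partial i g x.
Proof. by move=> df dg; rewrite /partial deriveD//; exact: diff_derivable. Qed.

Lemma partialB i f g x : differentiable f x -> differentiable g x ->
  partial i (fun y => f y - g y) x = partial i f x - partial i g x.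
Proof. by move=> df dg; rewrite /partial deriveB//; exact: diff_derivable. Qed.

Lemma partialM i f g x : differentiable f x -> differentiable g x ->
  partial i (fun y => f y * g y) x = f x * partial i g x + g x * partial i f x.
Proof. by move=> df dg; rewrite /partial deriveM//; exact: diff_derivable. Qed.

Lemma partial_cst i (c : R) x : partial i (fun=> c) x = 0.
Proof. exact: derive_cst. Qed.

Lemma partial_comp i (h : R -> R) f x :
  derivable h (f x) 1 -> differentiable f x ->
  partial i (fun y => h (f y)) x = 'D_1 h (f x) * partial i f x.
Proof.
move=> dh df; have dh' : differentiable h (f x) by exact/derivable1_diffP.
rewrite /partial deriveE; last exact: (differentiable_comp df).
rewrite [LHS](_ : _ = 'd h (f x) ('d f x (delta_mx ord0 i))); last first.
  by rewrite -[LHS]/('d (h \o f) x _) diff_comp.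
by rewrite (deriv1E dh) -deriveE// derive1E /= mulrC.
Qed.

Lemma differentiable_rV_coord i x :
  differentiable (fun y : 'rV[R]_n => y ord0 i) x.
Proof. exact: differentiable_coord. Qed.

Lemma partial_coord i j x :
  partial i (fun y : 'rV[R]_n => y ord0 j) x = (i == j)%:R.
Proof.
have := @derive_mx R 'rV[R]_n 1 n id x (delta_mx ord0 i) (@derivable_id _ _ _ _).
by rewrite derive_id => /matrixP/(_ ord0 j); rewrite !mxE/= eq_sym => ->.
Qed.

Lemma differentiable_big (s : seq 'I_n) (F : 'I_n -> 'rV[R]_n -> R) x :
  (forall j, differentiable (F j) x) ->
  differentiable (fun y => \sum_(j <- s) F j y) x.
Proof.
move=> dF; elim: s => [|j s IHs].
  by under eq_fun do rewrite big_nil; exact: differentiable_cst.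
under eq_fun do rewrite big_cons.
exact: (differentiableD (dF j) IHs).
Qed.

Lemma partial_sum i (s : seq 'I_n) (F : 'I_n -> 'rV[R]_n -> R) x :
  (forall j, differentiable (F j) x) ->
  partial i (fun y => \sum_(j <- s) F j y) x = \sum_(j <- s) partial i (F j) x.
Proof.
move=> dF; elim: s => [|j s IHs].
  by under eq_fun do rewrite big_nil; rewrite big_nil partial_cst.
under eq_fun do rewrite big_cons.
by rewrite big_cons partialD ?IHs//; exact: differentiable_big.
Qed.

Lemma differentiable_powR f a x : differentiable f x -> 0 < f x ->
  differentiable (fun y => f y `^ a) x.
Proof.
move=> df fx0; apply: (@differentiable_comp _ _ _ _ f (fun t : R => t `^ a)) => //.
by apply/derivable1_diffP; apply: derivable_powR; rewrite in_itv/= fx0.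
Qed.

Lemma partial_powR i f a x : differentiable f x -> 0 < f x ->
  partial i (fun y => f y `^ a) x = a * f x `^ (a - 1) * partial i f x.
Proof.
move=> df fx0; rewrite (@partial_comp i (fun t : R => t `^ a))//.
  by rewrite -derive1E powR_derive1// in_itv/= fx0.
by apply: derivable_powR; rewrite in_itv/= fx0.
Qed.

Lemma differentiable_exprn f k x : differentiable f x ->
  differentiable (fun y => f y ^+ k) x.
Proof.
move=> df; apply: (@differentiable_comp _ _ _ _ f (fun t : R => t ^+ k)) => //.
exact/derivable1_diffP/exprn_derivable.
Qed.

Lemma partial_exprn i f k x : differentiable f x ->
  partial i (fun y => f y ^+ k) x = k%:R * f x ^+ k.-1 * partial i f x.
Proof.
move=> df; rewrite (@partial_comp i (fun t : R => t ^+ k))//; last first.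
  exact: exprn_derivable.
by rewrite -derive1E exp_derive1.
Qed.

Lemma of_class_CW k f : of_class_C k.+1 f -> of_class_C k f.
Proof.
elim: k f => [|k IHk] f [df Cf] /=.
  by move=> x; exact: differentiable_continuous.
by split=> // i; exact: IHk.
Qed.

Lemma of_class_C_cst k (c : R) : of_class_C k (fun _ : 'rV[R]_n => c).
Proof.
elim: k c => [|k IHk] c /=; first by move=> x; exact: cst_continuous.
split => [x|i]; first exact: differentiable_cst.
by rewrite (_ : partial i _ = fun=> 0); [exact: IHk|apply/funext => x; exact: partial_cst].
Qed.

Lemma of_class_CD k f g : of_class_C k f -> of_class_C k g ->
  of_class_C k (fun x => f x + g x).
Proof.
elim: k f g => [|k IHk] f g /=.
  by move=> cf cg x; apply: continuousD; [exact: cf|exact: cg].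
move=> [df Cf] [dg Cg]; split => [x|i]; first exact: differentiableD.
rewrite (_ : partial i _ = fun x => partial i f x + partial i g x).
  by apply: IHk; [exact: Cf|exact: Cg].
by apply/funext => x; rewrite partialD.
Qed.

Lemma of_class_CM k f g : of_class_C k f -> of_class_C k g ->
  of_class_C k (fun x => f x * g x).
Proof.
elim: k f g => [|k IHk] f g.
  by move=> cf cg x; apply: continuousM; [exact: cf|exact: cg].
move=> Cf Cg; have Ckf := of_class_CW Cf; have Ckg := of_class_CW Cg.
case: Cf Cg => [df Cf] [dg Cg]; split => [x|i]; first exact: differentiableM.
rewrite (_ : partial i _ = fun x => f x * partial i g x + g x * partial i f x).
  by apply: of_class_CD; apply: IHk => //; [exact: Cg|exact: Cf].
by apply/funext => x; rewrite partialM.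
Qed.

(** The induction generalises the exponent, since differentiating replaces [a] by [a - 1]. *)
Lemma of_class_C_powR k f a : (forall x, 0 < f x) -> of_class_C k f ->
  of_class_C k (fun x => f x `^ a).
Proof.
move=> f0; elim: k a => [|k IHk] a Cf.
  move=> x; apply: (@continuous_comp _ _ _ f (fun t : R => t `^ a)); first exact: Cf.
  apply: differentiable_continuous; apply/derivable1_diffP.
  by apply: derivable_powR; rewrite in_itv/= f0.
have Ckf := of_class_CW Cf; case: Cf => [df Cf].
split => [x|i]; first exact: differentiable_powR.
rewrite (_ : partial i _ = fun x => a * f x `^ (a - 1) * partial i f x).
  apply: of_class_CM; last exact: Cf.
  by apply: of_class_CM; [exact: of_class_C_cst|exact: IHk].
by apply/funext => x; rewrite partial_powR.
Qed.

Lemma of_class_C_coord k i : of_class_C k (fun x : 'rV[R]_n => x ord0 i).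
Proof.
case: k => [|k]; first by move=> x; exact: coord_continuous.
split => [x|j]; first exact: differentiable_rV_coord.
rewrite (_ : partial j _ = fun=> (j == i)%:R); first exact: of_class_C_cst.
by apply/funext => x; rewrite partial_coord.
Qed.

Lemma of_class_C_sum k (s : seq 'I_n) (F : 'I_n -> 'rV[R]_n -> R) :
  (forall j, of_class_C k (F j)) -> of_class_C k (fun x => \sum_(j <- s) F j x).
Proof.
move=> CF; elim: s => [|j s IHs].
  by under eq_fun do rewrite big_nil; exact: of_class_C_cst.
by under eq_fun do rewrite big_cons; exact: of_class_CD.
Qed.

Definition smooth f := forall k, of_class_C k f.

Lemma smooth_continuous f : smooth f -> continuous f.
Proof. by move=> /(_ 0). Qed.

Lemma smooth_differentiable f x : smooth f -> differentiable f x.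
Proof. by move=> /(_ 1) []. Qed.

Lemma smooth_partial i f : smooth f -> smooth (partial i f).
Proof. by move=> Cf k; have [_] := Cf k.+1; exact. Qed.

Lemma smoothM f g : smooth f -> smooth g -> smooth (fun x => f x * g x).
Proof. by move=> Cf Cg k; exact: of_class_CM. Qed.

Lemma smoothD f g : smooth f -> smooth g -> smooth (fun x => f x + g x).
Proof. by move=> Cf Cg k; exact: of_class_CD. Qed.

Lemma smooth_cst (c : R) : smooth (fun=> c).
Proof. by move=> k; exact: of_class_C_cst. Qed.

Lemma smooth_powR f a : (forall x, 0 < f x) -> smooth f ->
  smooth (fun x => f x `^ a).
Proof. by move=> f0 Cf k; exact: of_class_C_powR. Qed.

Lemma smooth_sqn z : smooth (fun x => sqn (x - z)).
Proof.
move=> k; apply: of_class_C_sum => j.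
rewrite (_ : (fun x : 'rV[R]_n => _) =
  fun x : 'rV[R]_n => (x ord0 j + (- z ord0 j)) * (x ord0 j + (- z ord0 j))).
  by apply: of_class_CM; apply: of_class_CD;
    (exact: of_class_C_coord || exact: of_class_C_cst).
by apply/funext => x; rewrite !mxE.
Qed.

Lemma partial_sqn i z x : partial i (fun y => sqn (y - z)) x = 2 * (x ord0 i - z ord0 i).
Proof.
have dj j : differentiable (fun y : 'rV[R]_n => y ord0 j - z ord0 j) x.
  apply: differentiableB; [exact: differentiable_rV_coord|exact: differentiable_cst].
have -> : (fun y => sqn (y - z)) = fun y : 'rV[R]_n =>
    \sum_(j < n) ((y ord0 j - z ord0 j) * (y ord0 j - z ord0 j)).
  by apply/funext => y; apply: eq_bigr => j _; rewrite !mxE.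
rewrite partial_sum => [|j]; last exact: differentiableM.
rewrite (bigD1 i)//= big1 ?addr0 => [|j ji].
  rewrite partialM// partialB ?partial_coord ?partial_cst//.
  - by rewrite eqxx subr0 mulr1 -mulr2n mulr_natl.
  - exact: differentiable_rV_coord.
rewrite partialM// partialB ?partial_coord ?partial_cst//.
- by rewrite eq_sym (negPf ji) subrr mulr0 addr0.
- exact: differentiable_rV_coord.
Qed.

Lemma smooth_sqn0 : smooth (@sqn R n).
Proof.
have := smooth_sqn 0.
by rewrite (_ : (fun x => sqn (x - 0)) = @sqn R n)//; apply/funext => y; rewrite subr0.
Qed.

Lemma differentiable_sqn x : differentiable (@sqn R n) x.
Proof. exact/smooth_differentiable/smooth_sqn0. Qed.

Lemma partial_sqn0 i x : partial i (@sqn R n) x = 2 * x ord0 i.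
Proof.
have := partial_sqn i 0 x; rewrite mxE subr0 => <-; congr (partial i _ x).
by apply/funext => y; rewrite subr0.
Qed.

End partial_calculus.

(** * Integration on the hyperbolic ball *)

Section ball_integral.
Context (R : realType) (n : nat).
Local Notation mR := (measurableTypeR R).
Local Notation B := (@poincare_ball R n).
Implicit Types (f g : 'rV[R]_n -> R) (x : 'rV[R]_n).

Lemma sqn_ge0 x : 0 <= sqn x.
Proof. by apply: sumr_ge0 => i _; rewrite -expr2 sqr_ge0. Qed.

Lemma sqn_continuous : continuous (@sqn R n).
Proof.
by move=> x; exact/differentiable_continuous/differentiable_sqn.
Qed.

Lemma open_poincare_ball : open B.
Proof.
rewrite (_ : B = @sqn R n @^-1` [set t : R | t < 1]).
  by apply: open_comp => [x _|]; [exact: sqn_continuous|exact: open_lt].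
by [].
Qed.

Lemma measurable_poincare_ball : measurable (B : set 'rV[mR]_n).
Proof. by apply: open_measurable_rV; exact: open_poincare_ball. Qed.

Lemma sqr_coord_le x i : x ord0 i ^+ 2 <= sqn x.
Proof.
rewrite /sqn /dotr (bigD1 i)//= -expr2 lerDl.
by apply: sumr_ge0 => j _; rewrite -expr2 sqr_ge0.
Qed.

Lemma ball_sub_cube : B `<=` cube n 1.
Proof.
move=> x Bx i; have := le_trans (sqr_coord_le x i) (ltW Bx).
by rewrite -real_normK ?num_real// expr_le1// ler_norml /= in_itv.
Qed.

Lemma lebesgue_ball_lty : (lebesgue_rV R n B < +oo)%E.
Proof.
apply: le_lt_trans (lebesgue_cube_lty n 1).
apply: le_measure; rewrite ?inE; last exact: ball_sub_cube.
- exact: measurable_poincare_ball.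
- exact: measurable_cube.
Qed.

Lemma conformal_gt0 x : B x -> 0 < conformal x.
Proof. by move=> Bx; rewrite divr_gt0// subr_gt0. Qed.

Lemma differentiable_conformal x : B x -> differentiable (@conformal R n) x.
Proof.
move=> Bx; rewrite /conformal; apply: differentiableM.
  exact: differentiable_cst.
apply: differentiableV; last by rewrite subr_eq0 gt_eqF.
by apply: differentiableB; [exact: differentiable_cst|exact: differentiable_sqn].
Qed.

Lemma measurable_conformal : measurable_fun B (@conformal R n : 'rV[mR]_n -> mR).
Proof.
apply: open_continuous_measurable_fun_rV; first exact: open_poincare_ball.
move=> x; rewrite inE => Bx.
exact/differentiable_continuous/differentiable_conformal.
Qed.

Definition hintegrable f :=
  (lebesgue_rV R n).-integrable B (fun x => (f x * conformal x ^+ n)%:E).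

(** Real-valued integral, meaningful for integrable functions: [fine] sends an infinite value to
    0. *)
Definition hRint f : R := fine (hintegral f).

Local Notation hmeas f := (measurable_fun B (f : 'rV[mR]_n -> mR)).

Let mB := measurable_poincare_ball.

Lemma measurable_density f : hmeas f ->
  measurable_fun B (fun x : 'rV[mR]_n => (f x * conformal x ^+ n)%:E).
Proof.
move=> mf; apply/measurable_EFinP; apply: measurable_funM => //.
exact: measurable_funX measurable_conformal.
Qed.

Lemma hintegralE f : hintegrable f -> hintegral f = (hRint f)%:E.
Proof. by move=> fi; rewrite fineK//; exact: integrable_fin_num. Qed.

Lemma hintegrable0 : hintegrable (fun=> 0).
Proof.
rewrite /hintegrable (_ : (fun x => _) = cst 0%E); first exact: integrable0.
by apply/funext => x; rewrite mul0r.
Qed.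

Lemma hRint0 : hRint (fun=> 0) = 0.
Proof.
rewrite /hRint /hintegral -[RHS]/(fine 0%E); congr fine.
by apply: integral0_eq => x _; rewrite mul0r.
Qed.

Lemma hintegrableD f g : hintegrable f -> hintegrable g ->
  hintegrable (fun x => f x + g x).
Proof.
move=> fi gi; apply: eq_integrable (integrableD mB fi gi) => //.
by move=> x _ /=; rewrite mulrDl EFinD.
Qed.

Lemma hRintD f g : hintegrable f -> hintegrable g ->
  hRint (fun x => f x + g x) = hRint f + hRint g.
Proof.
move=> fi gi; apply: EFin_inj; rewrite -hintegralE; last exact: hintegrableD.
rewrite EFinD -!hintegralE// -integralD//.
by apply: eq_integral => x _; rewrite mulrDl EFinD.
Qed.

Lemma hintegrableZ c f : hintegrable f -> hintegrable (fun x => c * f x).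
Proof.
move=> fi; apply: eq_integrable (integrableZl mB c fi) => //.
by move=> x _ /=; rewrite -EFinM mulrA.
Qed.

Lemma hRintZ c f : hintegrable f -> hRint (fun x => c * f x) = c * hRint f.
Proof.
move=> fi; apply: EFin_inj; rewrite -hintegralE; last exact: hintegrableZ.
rewrite EFinM -hintegralE// -integralZl//.
by apply: eq_integral => x _; rewrite -EFinM mulrA.
Qed.

Lemma hintegrableB f g : hintegrable f -> hintegrable g ->
  hintegrable (fun x => f x - g x).
Proof.
move=> fi gi; rewrite (_ : (fun x => _) = fun x => f x + (-1) * g x).
  by apply: hintegrableD => //; exact: hintegrableZ.
by apply/funext => x; rewrite mulN1r.
Qed.

Lemma hRintB f g : hintegrable f -> hintegrable g ->
  hRint (fun x => f x - g x) = hRint f - hRint g.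
Proof.
move=> fi gi; rewrite (_ : (fun x => f x - g x) = fun x => f x + (-1) * g x).
  by rewrite hRintD ?hRintZ ?mulN1r//; exact: hintegrableZ.
by apply/funext => x; rewrite mulN1r.
Qed.

Lemma hRint_le f g : hintegrable f -> hintegrable g ->
  (forall x, B x -> f x <= g x) -> hRint f <= hRint g.
Proof.
move=> fi gi fg; rewrite -lee_fin -!hintegralE//; apply: le_integral => // x.
rewrite inE => Bx; rewrite lee_fin ler_wpM2r// ?fg// exprn_ge0// ltW//.
exact: conformal_gt0.
Qed.

Lemma hRint_le_lin a b f g h : hintegrable f -> hintegrable g -> hintegrable h ->
  (forall x, B x -> f x <= a * g x + b * h x) ->
  hRint f <= a * hRint g + b * hRint h.
Proof.
move=> fi gi hi fgh; rewrite -!hRintZ// -hRintD; try exact: hintegrableZ.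
by apply: hRint_le => //; apply: hintegrableD; exact: hintegrableZ.
Qed.

(** Integrability is not asked for: an infinite integral is read as 0 by [fine]. *)
Lemma hRint_ge0 f : (forall x, B x -> 0 <= f x) -> 0 <= hRint f.
Proof.
move=> f0; apply: fine_ge0; apply: integral_ge0 => x Bx.
by rewrite lee_fin mulr_ge0 ?f0// exprn_ge0// ltW// conformal_gt0.
Qed.

Lemma hintegrable_le f g : hmeas f -> hintegrable g ->
  (forall x, B x -> `|f x| <= g x) -> hintegrable f.
Proof.
move=> mf gi fg; apply: (le_integrable mB _ _ gi); first exact: measurable_density.
move=> x Bx; rewrite lee_fin !normrM ler_wpM2r//.
by rewrite (le_trans (fg _ Bx))// ler_norm.
Qed.

Lemma ge0_hintegrable f : hmeas f -> (forall x, B x -> 0 <= f x) ->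
  (hintegral f < +oo)%E -> hintegrable f.
Proof.
move=> mf f0 foo; apply/integrableP; split; first exact: measurable_density.
apply: le_lt_trans foo; rewrite le_eqVlt; apply/orP; left; apply/eqP.
apply: eq_integral => x; rewrite inE => Bx /=; rewrite ger0_norm//.
by rewrite mulr_ge0 ?f0// exprn_ge0// ltW// conformal_gt0.
Qed.

Lemma ge0_le_hintegral f g : hmeas f -> hmeas g ->
  (forall x, B x -> 0 <= f x) -> (forall x, B x -> f x <= g x) ->
  (hintegral f <= hintegral g)%E.
Proof.
move=> mf mg f0 fg; have c0 x : B x -> 0 <= conformal x ^+ n.
  by move=> Bx; rewrite exprn_ge0// ltW// conformal_gt0.
apply: ge0_le_integral => //.
- by move=> x Bx; rewrite lee_fin mulr_ge0 ?f0 ?c0.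
- exact: measurable_density.
- exact: measurable_density.
- by move=> x Bx; rewrite lee_fin ler_wpM2r ?fg ?c0.
Qed.

(** The hyperbolic density blows up at the unit sphere but is bounded on [K], and the ball has
    finite Lebesgue measure. *)
Lemma hintegrable_compact (K : set 'rV[R]_n) f : compact K -> K `<=` B ->
  continuous f -> (forall x, ~ K x -> f x = 0) -> hintegrable f.
Proof.
move=> cK KB cf f0.
have [C C0 fC] : exists2 C, 0 < C &
    forall x, K x -> `|f x * conformal x ^+ n| <= C.
  apply: continuous_compact_bounded cK _; apply: continuous_in_subspaceT => x.
  rewrite inE => /KB Bx.
  apply: (@continuousM _ _ f (fun x => conformal x ^+ n)); first exact: cf.
  apply: differentiable_continuous; apply: differentiable_exprn.
  exact: differentiable_conformal.
apply: measurable_bounded_integrable => //; first exact: lebesgue_ball_lty.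
  apply: measurable_funM; last exact: measurable_funX measurable_conformal.
  by apply: measurable_funTS; exact: continuous_measurable_fun_rV.
exists C; split => [|M CM x _ /=]; first exact: num_real.
rewrite (le_trans _ (ltW CM))//; have [/fC//|/f0 ->] := pselect (K x).
by rewrite mul0r normr0 ltW.
Qed.

End ball_integral.
Notation hmeasurable f := (measurable_fun (@poincare_ball _ _)
  (f : 'rV[measurableTypeR _]_ _ -> measurableTypeR _)).

(** * Test functions and the Poincare inequality *)

Section test_functions.
Context (R : realType) (n : nat).
Local Notation mR := (measurableTypeR R).
Local Notation B := (@poincare_ball R n).
Implicit Types (f g phi psi : 'rV[R]_n -> R) (x : 'rV[R]_n).

Lemma test_smooth phi : test_function phi -> smooth phi.
Proof. by case. Qed.

Lemma notin_support_near phi x : ~ closure [set x | phi x != 0] x ->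
  \forall y \near x, phi y = 0.
Proof.
move=> /= ncl; have : nbhs x (~` closure [set x | phi x != 0]).
  by apply: open_nbhs_nbhs; split => //; apply: closed_openC; exact: closed_closure.
apply: filterS => y /= ny; apply/eqP; apply: contra_notT ny => py.
exact: subset_closure.
Qed.

Lemma notin_support0 phi x : ~ closure [set x | phi x != 0] x -> phi x = 0.
Proof. by move=> /notin_support_near/nbhs_singleton. Qed.

Lemma partial_near0 i phi x : (\forall y \near x, phi y = 0) ->
  partial i phi x = 0.
Proof.
move=> px; rewrite -[RHS](derive_cst (0 : R) x (delta_mx ord0 i)).
exact: near_eq_derive.
Qed.

Lemma test_functionM f phi : smooth f -> test_function phi ->
  test_function (fun x => f x * phi x).
Proof.
move=> Cf [Cphi cphi phiB].
have S : closure [set x | f x * phi x != 0] `<=` closure [set x | phi x != 0].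
  by apply: closureS => x /=; rewrite mulf_eq0 negb_or => /andP[].
split; first exact: smoothM.
  by apply: subclosed_compact cphi S; exact: closed_closure.
exact: subset_trans S phiB.
Qed.

Lemma test_functionB phi psi : test_function phi -> test_function psi ->
  test_function (fun x => phi x - psi x).
Proof.
move=> [Cphi cphi phiB] [Cpsi cpsi psiB].
have S : closure [set x | phi x - psi x != 0] `<=`
    closure [set x | phi x != 0] `|` closure [set x | psi x != 0].
  rewrite -closureU; apply: closureS => x /=.
  case: (eqVneq (phi x) 0) => [->|]; last by left.
  by rewrite sub0r oppr_eq0; right.
split.
- rewrite (_ : (fun x => _) = fun x => phi x + (-1) * psi x).
    by apply: smoothD => //; apply: smoothM => //; exact: smooth_cst.
  by apply/funext => x; rewrite mulN1r.
- by apply: subclosed_compact (compactU cphi cpsi) S; exact: closed_closure.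
- by apply: subset_trans S _ => x [/phiB|/psiB].
Qed.

(** Vanishing is required only where [phi] is zero on a neighbourhood, a condition that expressions
    in the derivatives of [phi] also meet. *)
Lemma hintegrable_test phi f : test_function phi -> continuous f ->
  (forall x, (\forall y \near x, phi y = 0) -> f x = 0) -> hintegrable f.
Proof.
move=> [_ cphi phiB] cf f0; apply: (hintegrable_compact cphi) => // x.
by move=> /notin_support_near; exact: f0.
Qed.

(** Serves for functions containing [conformal], which is singular on the sphere: the support [K] is
    closed and inside the ball, so [f] is zero near every point outside the ball. *)
Lemma continuous_supported (K : set 'rV[R]_n) f : closed K -> K `<=` B ->
  (forall x, B x -> {for x, continuous f}) ->
  (forall x, ~ K x -> f x = 0) -> continuous f.
Proof.
move=> cK KB cf f0 x; have [/cf//|Bx] := pselect (B x).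
have nKx : nbhs x (~` K).
  by apply: open_nbhs_nbhs; split; [exact: closed_openC|move/KB].
have f0x : \forall y \near x, (fun=> 0) y = f y by apply: filterS nKx => y /f0.
rewrite /continuous_at f0; last by move/KB.
by apply: cvg_trans (near_eq_cvg f0x) _; exact: cvg_cst.
Qed.

Lemma partial_conformal i x : B x -> partial i (@conformal R n) x = conformal x ^+ 2 * x ord0 i.
Proof.
move=> Bx; have d0 : 1 - sqn x != 0 by rewrite subr_eq0 gt_eqF.
have dsqn := @differentiable_sqn R n x.
have d1 : differentiable (fun y => 1 - @sqn R n y) x.
  exact: (differentiableB (differentiable_cst (1 : R) x) dsqn).
have p1 : partial i (fun y => 1 - @sqn R n y) x = - (2 * x ord0 i).
  by rewrite (partialB i (differentiable_cst (1 : R) x) dsqn) partial_cst partial_sqn0 sub0r.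
have pV : partial i (fun y => (1 - @sqn R n y)^-1) x =
    - (1 - sqn x) ^- 2 * partial i (fun y => 1 - @sqn R n y) x.
  by apply: (@deriveV _ _ (fun y => 1 - @sqn R n y)) => //; exact: diff_derivable.
have dV : differentiable (fun y => (1 - @sqn R n y)^-1) x by exact: differentiableV.
rewrite /conformal (partialM i (differentiable_cst (2 : R) x) dV).
rewrite partial_cst mulr0 addr0 pV p1.
by field.
Qed.

(* Also valid on the unit sphere, where 2 / 0 = 0 makes both sides vanish. *)
Lemma hgrad_dotE x v w : hgrad_dot x v w = ((1 - @sqn R n x) / 2) ^+ 2 * dotr v w.
Proof. by rewrite /hgrad_dot /conformal -exprVn invf_div. Qed.

Lemma hintegrable_hgrad_test phi : test_function phi ->
  hintegrable (fun x => hgrad_dot x (gradient phi x) (gradient phi x)).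
Proof.
move=> tphi; apply: (hintegrable_test tphi) => [x|x p0]; last first.
  rewrite hgrad_dotE /dotr big1 ?mulr0// => i _.
  by rewrite !mxE partial_near0// mulr0.
apply: differentiable_continuous; under eq_fun do rewrite hgrad_dotE.
apply: differentiableM.
  apply: differentiable_exprn; apply: differentiableM; last exact: differentiable_cst.
  by apply: differentiableB; [exact: differentiable_cst|exact: differentiable_sqn].
apply: differentiable_big => i; under eq_fun do rewrite !mxE.
by apply: differentiableM; exact/smooth_differentiable/smooth_partial/test_smooth.
Qed.

End test_functions.

(** * The Poincare inequality with constant ((n-1)/2)^2, from a divergence identity *)

Section poincare_inequality.
Context (R : realType).
Local Notation mR := (measurableTypeR R).

Section field.
Context (m : nat) (phi : 'rV[R]_m.+1 -> R) (tphi : test_function phi).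
Local Notation B := (@poincare_ball R m.+1).
Implicit Types (x : 'rV[R]_m.+1) (i : 'I_m.+1).

(* g is the vector field phi^2 conformal^(n-1) x, and e its divergence divided
   by the volume density. With s = (n-1)/2, the quantity
   |grad phi|^2 - s^2 phi^2 + s * sum_i e_i is a sum of nonnegative terms. *)
Let g i x := phi x ^+ 2 * (conformal x ^+ m * x ord0 i).
Let e i x := (1 - sqn x) * (phi x * partial i phi x * x ord0 i) +
  phi x ^+ 2 * (m%:R * x ord0 i ^+ 2 + (1 - sqn x) / 2).

Let dphi x : differentiable phi x.
Proof. exact/smooth_differentiable/test_smooth. Qed.

Let differentiable_field i x : B x ->
  differentiable (fun y => conformal y ^+ m * y ord0 i) x.
Proof.
move=> Bx; apply: differentiableM; last exact: differentiable_rV_coord.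
exact/differentiable_exprn/differentiable_conformal.
Qed.

Let field_near0 i x : (\forall y \near x, phi y = 0) ->
  \forall y \near x, g i y = 0.
Proof. by apply: filterS => y; rewrite /g => ->; rewrite expr0n mul0r. Qed.

Let derivable_field i x : derivable (g i) x (delta_mx ord0 i).
Proof.
have [Bx|Bx] := pselect (B x).
  apply: diff_derivable; apply: differentiableM; last exact: differentiable_field.
  exact: differentiable_exprn.
(* Outside the ball, the singular sphere included, [g i] vanishes on a neighbourhood because [phi]
   does. *)
apply: (@near_eq_derivable _ _ _ (fun=> 0)); last exact: derivable_cst.
have [_ _ phiB] := tphi.
have /notin_support_near/(@field_near0 i) : ~ closure [set y | phi y != 0] x.
  by move/phiB.
by apply: filterS => y ->.
Qed.

Let partial_field i x : B x -> partial i (g i) x = e i x * conformal x ^+ m.+1.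
Proof.
move=> Bx; have dl := differentiable_conformal Bx.
rewrite /g partialM; [|exact: differentiable_exprn|exact: differentiable_field].
rewrite partialM; [|exact: differentiable_exprn|exact: differentiable_rV_coord].
rewrite !partial_exprn// partial_conformal// partial_coord eqxx /=.
have d0 : 1 - sqn x != 0 by rewrite subr_eq0 gt_eqF.
(* For [m = 0] the exponent [m.-1] is truncated and the powers of [conformal] disagree, but the
   factor [m%:R] is then 0. *)
have -> : m%:R * conformal x ^+ m.-1 * (conformal x ^+ 2 * x ord0 i) =
    m%:R * conformal x ^+ m.+1 * x ord0 i.
  rewrite mulrA; congr (_ * _); case: m {dl Bx} (conformal x) => [|k] l; first by rewrite !mul0r.
  by rewrite -mulrA -exprD addn2.
rewrite /e [conformal x ^+ m.+1]exprS /conformal; set L := _ ^+ m.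
by field.
Qed.

Let continuous_e i : continuous (e i).
Proof.
move=> x; apply: differentiable_continuous.
have dsqn : differentiable (fun y => 1 - @sqn R m.+1 y) x.
  by apply: differentiableB; [exact: differentiable_cst|exact: differentiable_sqn].
have dx := differentiable_rV_coord i x.
have dp : differentiable (partial i phi) x.
  exact/smooth_differentiable/smooth_partial/test_smooth.
apply: differentiableD; apply: differentiableM => //.
- by apply: differentiableM => //; exact: differentiableM.
- exact: differentiable_exprn.
- apply: differentiableD; last by apply: differentiableM => //; exact: differentiable_cst.
  by apply: differentiableM; [exact: differentiable_cst|exact: differentiable_exprn].
Qed.

Let e_near0 i x : (\forall y \near x, phi y = 0) -> e i x = 0.
Proof. by move/nbhs_singleton => p0; rewrite /e p0; ring. Qed.

Let hintegrable_e i : hintegrable (e i).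
Proof.
by apply: (hintegrable_test tphi); [exact: continuous_e|exact: e_near0].
Qed.

Let continuous_partial_field i : continuous (partial i (g i)).
Proof.
have [_ _ phiB] := tphi.
apply: (continuous_supported _ phiB) => [|x Bx|x /notin_support_near]; last first.
- by move=> p0; apply: partial_near0; exact: field_near0.
- have eg : \forall y \near x, e i y * conformal y ^+ m.+1 = partial i (g i) y.
    have : nbhs x B by apply: open_nbhs_nbhs; split => //; exact: open_poincare_ball.
    by apply: filterS => y By; rewrite partial_field.
  suff : partial i (g i) y @[y --> x] --> partial i (g i) x by [].
  rewrite partial_field//; apply: cvg_trans (near_eq_cvg eg) _.
  apply: cvgM; first exact: continuous_e.
  apply: (@differentiable_continuous _ _ _ x (fun y => conformal y ^+ m.+1)).
  exact/differentiable_exprn/differentiable_conformal.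
- exact: closed_closure.
Qed.

Let hRint_e i : hRint (e i) = 0.
Proof.
have [_ _ phiB] := tphi.
rewrite /hRint /hintegral -[RHS]/(fine 0%E); congr fine.
transitivity (\int[lebesgue_rV R m.+1]_x (partial i (g i) x)%:E)%E.
  rewrite integral_mkcond; apply: eq_integral => x _; rewrite patchE.
  case: ifPn; first by rewrite inE => Bx; rewrite partial_field.
  rewrite notin_setE => Bx; rewrite partial_near0//; apply: field_near0.
  by apply: notin_support_near => /phiB.
apply: (@integral_partial_eq0 _ _ _ _ 1) => //.
move=> x j xj; rewrite /g notin_support0 ?expr0n ?mul0r// => /phiB Bx.
have /(_ j) := ball_sub_cube Bx; rewrite /= in_itv/= -ler_norml.
by rewrite leNgt xj.
Qed.

Lemma poincare_inequality_succ :
  (m%:R / 2) ^+ 2 * hRint (fun x => phi x ^+ 2) <=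
  hRint (fun x => hgrad_dot x (gradient phi x) (gradient phi x)).
Proof.
have [hg hp] : hintegrable (fun x => hgrad_dot x (gradient phi x) (gradient phi x)) /\
    hintegrable (fun x => phi x ^+ 2).
  split.
    exact: hintegrable_hgrad_test.
  apply: (hintegrable_test tphi) => [x|x /nbhs_singleton ->]; last by rewrite expr0n.
  exact/differentiable_continuous/differentiable_exprn.
pose s : R := m%:R / 2.
pose E x := \sum_(i < m.+1) e i x.
have [iE hE] : hintegrable E /\ hRint E = 0.
  rewrite /E; elim: (index_enum _) => [|i r [ir hr]].
    rewrite (_ : (fun x => _) = fun=> 0); last by apply/funext => x; rewrite big_nil.
    by split; [exact: hintegrable0|exact: hRint0].
  have -> : (fun x => \sum_(j <- i :: r) e j x) =
      (fun x => e i x + \sum_(j <- r) e j x) by apply/funext => x; rewrite big_cons.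
  by rewrite hRintD// hr hRint_e addr0; split => //; exact: hintegrableD.
rewrite -subr_ge0 -hRintZ// -hRintB//; last exact: hintegrableZ.
(* Adding [s * E], of integral 0, completes the square: with [k = 1 / conformal], the integrand
   becomes |k grad phi + s phi x|^2 + s k phi^2. *)
rewrite -[leRHS]addr0 -[X in _ + X](mulr0 s) -[X in s * X]hE -hRintZ// -hRintD//; last 2 first.
  by apply: hintegrableB => //; exact: hintegrableZ.
  exact: hintegrableZ.
apply: hRint_ge0 => x Bx; have r1 : 0 < 1 - sqn x by rewrite subr_gt0.
pose k := (1 - sqn x) / 2.
have sq : \sum_(i < m.+1) (k * partial i phi x + s * phi x * x ord0 i) ^+ 2 =
   k ^+ 2 * dotr (gradient phi x) (gradient phi x) +
   2 * k * s * phi x * dotr x (gradient phi x) + s ^+ 2 * phi x ^+ 2 * sqn x.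
  rewrite /sqn /dotr !mulr_sumr -!big_split/=; apply: eq_bigr => i _.
  by rewrite !mxE; ring.
have sE : E x = 2 * k * phi x * dotr x (gradient phi x) +
   phi x ^+ 2 * (m%:R * sqn x + m.+1%:R * k).
  rewrite /E /e big_split/= -!mulr_sumr big_split/= -mulr_sumr.
  rewrite sumr_const card_ord -/k; congr (_ + _ * (_ * _ + _)).
    rewrite /dotr !mulr_sumr; apply: eq_bigr => i _.
    by rewrite mxE /k; field.
  by rewrite mulr_natl.
have sq0 : 0 <= \sum_(i < m.+1) (k * partial i phi x + s * phi x * x ord0 i) ^+ 2.
  by apply: sumr_ge0 => i _; exact: sqr_ge0.
have sk0 : 0 <= s * k * phi x ^+ 2.
  by rewrite mulr_ge0 ?sqr_ge0// mulr_ge0// divr_ge0// ltW.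
rewrite hgrad_dotE sE -/k.
apply: le_trans (addr_ge0 sq0 sk0) _; rewrite sq -natr1 le_eqVlt; apply/orP; left.
by apply/eqP; rewrite /k /s; field.
Qed.
End field.

End poincare_inequality.

(** * Approximation in H^1 *)

Section fatou.
Context (R : realType) (n : nat).
Local Notation mR := (measurableTypeR R).
Local Notation B := (@poincare_ball R n).

Lemma ae_subset d (T : measurableType d) (mu : {measure set T -> \bar R})
    (P Q : T -> Prop) : (forall x, P x -> Q x) ->
  {ae mu, forall x, P x} -> {ae mu, forall x, Q x}.
Proof. by move=> PQ; apply: filterS. Qed.

Lemma fatou_bound d (T : measurableType d) (mu : {measure set T -> \bar R})
    (D : set T) (f_ : nat -> T -> \bar R) (f : T -> \bar R) (M : \bar R) :
  measurable D -> (forall k, measurable_fun D (f_ k)) -> measurable_fun D f ->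
  (forall k x, D x -> (0 <= f_ k x)%E) -> (forall x, D x -> (0 <= f x)%E) ->
  {ae mu, forall x, D x -> f_ k x @[k --> \oo] --> f x} ->
  (\forall k \near \oo, (\int[mu]_(x in D) f_ k x <= M)%E) ->
  (\int[mu]_(x in D) f x <= M)%E.
Proof.
move=> mD mf_ mf f_0 f0 f_f f_M.
(* Convergence holds only almost everywhere, so [f] is first replaced by the lower limit, to which
   Fatou's lemma applies. *)
have -> : (\int[mu]_(x in D) f x = \int[mu]_(x in D) limn_einf (f_ ^~ x))%E.
  apply: ge0_ae_eq_integral => //.
  - by apply: measurableT_comp => //; apply: measurable_fun_limn_esup => k;
      exact: measurableT_comp.
  - move=> x Dx; rewrite limn_einf_lim; apply: lime_ge; first exact: is_cvg_einfs.
    by apply: nearW => k; apply: le_ereal_inf_tmp => _ [m /= _ <-]; exact: f_0.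
  - by apply: filterS f_f => x f_f Dx; have [-> _] := cvg_limn_einf_sup (f_f Dx).
apply: le_trans (fatou mu mD mf_ f_0) _; rewrite limn_einf_lim.
apply: lime_le; first exact: is_cvg_einfs.
by apply: filterS f_M => k; apply: le_trans; apply: ereal_inf_lbound; exists k => /=.
Qed.

Lemma hintegral_fatou_bound (f_ : nat -> 'rV[R]_n -> R) f (M : R) :
  (forall k, hmeasurable (f_ k)) -> hmeasurable f ->
  (forall k x, B x -> 0 <= f_ k x) -> (forall x, B x -> 0 <= f x) ->
  {ae lebesgue_rV R n, forall x, B x -> f_ k x @[k --> \oo] --> f x} ->
  (\forall k \near \oo, (hintegral (f_ k) <= M%:E)%E) ->
  (hintegral f <= M%:E)%E.
Proof.
move=> mf_ mf f_0 f0 f_f f_M.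
have c0 x : B x -> 0 <= conformal x ^+ n.
  by move=> Bx; rewrite exprn_ge0// ltW// conformal_gt0.
apply: (@fatou_bound _ _ (lebesgue_rV R n) B
  (fun k x => (f_ k x * conformal x ^+ n)%:E)) => //.
- exact: measurable_poincare_ball.
- by move=> k; exact: measurable_density.
- exact: measurable_density.
- by move=> k x Bx; rewrite lee_fin mulr_ge0 ?f_0 ?c0.
- by move=> x Bx; rewrite lee_fin mulr_ge0 ?f0 ?c0.
- apply: ae_subset f_f => x f_f Bx; apply: cvg_EFin; first exact: nearW.
  by apply: cvgM; [exact: f_f|exact: cvg_cst].
Qed.

End fatou.

Section H1_approximation.
Context (R : realType) (n : nat).
Local Notation mR := (measurableTypeR R).
Local Notation B := (@poincare_ball R n).

Lemma hmeasurable_hgrad_dot (v w : 'rV[R]_n -> 'rV[R]_n) :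
  (forall i, hmeasurable (fun x => v x ord0 i)) ->
  (forall i, hmeasurable (fun x => w x ord0 i)) ->
  hmeasurable (fun x => hgrad_dot x (v x) (w x)).
Proof.
move=> mv mw; under eq_fun do rewrite hgrad_dotE.
apply: measurable_funM.
  apply: measurable_funTS; apply: continuous_measurable_fun_rV => x.
  apply: differentiable_continuous; apply: differentiable_exprn.
  apply: differentiableM; last exact: differentiable_cst.
  by apply: differentiableB; [exact: differentiable_cst|exact: differentiable_sqn].
rewrite /dotr; elim: (index_enum _) => [|i r IHr].
  by under eq_fun do rewrite big_nil; exact: measurable_cst.
under eq_fun do rewrite big_cons.
by apply: measurable_funD => //; apply: measurable_funM; [exact: mv|exact: mw].
Qed.

Lemma hmeasurable_smooth (f : 'rV[R]_n -> R) : smooth f -> hmeasurable f.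
Proof.
move=> Cf; apply: measurable_funTS; apply: continuous_measurable_fun_rV.
exact: smooth_continuous.
Qed.

Lemma hgrad_dot_ge0 (x v : 'rV[R]_n) : 0 <= hgrad_dot x v v.
Proof. by rewrite hgrad_dotE mulr_ge0 ?sqr_ge0// sqn_ge0. Qed.

Lemma hgrad_dotB_le (x v w : 'rV[R]_n) :
  hgrad_dot x (v - w) (v - w) <= 2 * hgrad_dot x v v + 2 * hgrad_dot x w w.
Proof.
rewrite !hgrad_dotE !(mulrCA 2) -mulrDr ler_wpM2l ?sqr_ge0//.
rewrite /dotr !mulr_sumr -big_split; apply: ler_sum => i _ /=; rewrite !mxE.
by have := sqr_ge0 (v ord0 i + w ord0 i); nra.
Qed.

Lemma hintegrable_hgrad_diff phi (G : 'rV[R]_n -> 'rV[R]_n) : test_function phi ->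
  measurable_fun B (G : 'rV[mR]_n -> 'rV[mR]_n) ->
  (hintegral (fun x => hgrad_dot x (gradient phi x - G x) (gradient phi x - G x)) < +oo)%E ->
  hintegrable (fun x => hgrad_dot x (gradient phi x - G x) (gradient phi x - G x)).
Proof.
move=> tphi mG; apply: ge0_hintegrable => [|x _]; last exact: hgrad_dot_ge0.
have mi i : hmeasurable (fun x => (gradient phi x - G x) ord0 i).
  under eq_fun do rewrite !mxE.
  apply: measurable_funB.
    by apply: hmeasurable_smooth; apply: smooth_partial; exact: test_smooth.
  exact: measurableT_comp (measurable_coord i) mG.
exact: hmeasurable_hgrad_dot.
Qed.

Lemma poincare_inequality phi : (0 < n)%N -> test_function phi ->
  ((n%:R - 1) / 2) ^+ 2 * hRint (fun x => phi x ^+ 2) <=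
  hRint (fun x => @hgrad_dot R n x (gradient phi x) (gradient phi x)).
Proof.
case: n phi => // m phi _ tphi; rewrite -natr1 addrK.
exact: poincare_inequality_succ.
Qed.

Lemma gradientB phi psi x : smooth phi -> smooth psi ->
  gradient (fun y => phi y - psi y) x = gradient phi x - @gradient R n psi x.
Proof.
move=> Cphi Cpsi; apply/rowP => i; rewrite !mxE partialB//;
exact: smooth_differentiable.
Qed.

(* The Poincare inequality makes phi_ a Cauchy sequence in L^2(dv); Fatou's lemma
   in the second index then identifies its limit as Psi. *)
Lemma H1_gradient_approx (Psi : 'rV[R]_n -> R) G (phi_ : nat -> 'rV[R]_n -> R) :
  (1 < n)%N ->
  hmeasurable Psi -> measurable_fun B (G : 'rV[mR]_n -> 'rV[mR]_n) ->
  (forall k, test_function (phi_ k)) ->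
  hintegral (fun x => hgrad_dot x (gradient (phi_ k) x - G x)
                                  (gradient (phi_ k) x - G x))
    @[k --> \oo] --> 0%E ->
  {ae lebesgue_rV R n, forall x, B x -> phi_ k x @[k --> \oo] --> Psi x} ->
  forall e : R, 0 < e -> \forall k \near \oo,
    [/\ hintegrable (fun x => hgrad_dot x (gradient (phi_ k) x - G x)
                                          (gradient (phi_ k) x - G x)),
        hRint (fun x => hgrad_dot x (gradient (phi_ k) x - G x)
                                    (gradient (phi_ k) x - G x)) <= e,
        hintegrable (fun x => (phi_ k x - Psi x) ^+ 2) &
        hRint (fun x => (phi_ k x - Psi x) ^+ 2) <= e].
Proof.
have quarter (a b : R) : a <= b / 4 -> 2 * a + 2 * a <= b by lra.
move=> n1 mPsi mG tphi phiG phiPsi e e0.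
pose L : R := ((n%:R - 1) / 2) ^+ 2.
have L0 : 0 < L by rewrite exprn_gt0// divr_gt0// subr_gt0 ltr1n.
pose D k x := hgrad_dot x (gradient (phi_ k) x - G x) (gradient (phi_ k) x - G x).
(* Two gradients at squared distance at most [c] from [G] are at squared distance at most
   [2 * c + 2 * c <= L * e] from each other, and the Poincare inequality divides this by [L], which
   is positive because [1 < n]. *)
pose c : R := Num.min e (L * e / 4).
have c0 : 0 < c by rewrite lt_min e0/= divr_gt0// mulr_gt0.
have Dc : \forall k \near \oo, hintegrable (D k) /\ hRint (D k) <= c.
  have : \forall k \near \oo, (hintegral (D k) < c%:E)%E.
    by apply: (phiG _ (open_ereal_lt' _)); rewrite lte_fin.
  apply: filterS => k Dkc; have iD : hintegrable (D k).
    by apply: hintegrable_hgrad_diff => //; exact: lt_trans Dkc (ltry _).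
  by split => //; rewrite -lee_fin -hintegralE// ltW.
near=> k; have [iDk Dkc] : hintegrable (D k) /\ hRint (D k) <= c by near: k.
have mk l : hmeasurable (phi_ l) by apply: hmeasurable_smooth; exact: test_smooth.
have m2 : hmeasurable (fun x => (phi_ k x - Psi x) ^+ 2).
  by apply: measurable_funX; apply: measurable_funB; [exact: mk|exact: mPsi].
have dke : (hintegral (fun x => (phi_ k x - Psi x) ^+ 2)%R <= e%:E)%E.
  apply: (hintegral_fatou_bound (f_ := fun l x => (phi_ k x - phi_ l x) ^+ 2)) => //.
  - by move=> l; apply: measurable_funX; apply: measurable_funB; exact: mk.
  - by move=> *; exact: sqr_ge0.
  - by move=> *; exact: sqr_ge0.
  - apply: ae_subset phiPsi => x phiPsi Bx.
    apply: (cvg_comp _ (fun t : R => t ^+ 2)); last exact: exprn_continuous.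
    by apply: cvgB; [exact: cvg_cst|exact: phiPsi].
  apply: (filterS _ Dc) => l [iDl Dlc].
  have td := test_functionB (tphi k) (tphi l).
  have i2 : hintegrable (fun x => (phi_ k x - phi_ l x) ^+ 2).
    apply: (hintegrable_test td) => [x|x /nbhs_singleton ->]; last by rewrite expr0n.
    apply: differentiable_continuous; apply: differentiable_exprn.
    by apply: smooth_differentiable; exact: test_smooth.
  rewrite hintegralE// lee_fin -(ler_pM2l L0).
  apply: le_trans (poincare_inequality (ltnW n1) td) _.
  apply: (@le_trans _ _ (2 * c + 2 * c)); last first.
    by apply: quarter; rewrite ge_min lexx orbT.
  apply: (@le_trans _ _ (2 * hRint (D k) + 2 * hRint (D l))).
    2: by exact: (lerD (ler_wpM2l (ler0n R 2) Dkc) (ler_wpM2l (ler0n R 2) Dlc)).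
  apply: (hRint_le_lin (hintegrable_hgrad_test td) iDk iDl) => x _.
  rewrite (gradientB x (test_smooth (tphi k)) (test_smooth (tphi l))).
  by rewrite (le_trans _ (hgrad_dotB_le _ _ _))// opprB addrA subrK.
have i2 : hintegrable (fun x => (phi_ k x - Psi x) ^+ 2).
  apply: ge0_hintegrable => // [x _|]; first exact: sqr_ge0.
  exact: le_lt_trans dke (ltry _).
split => //; first by rewrite (le_trans Dkc)// ge_min lexx.
by rewrite -lee_fin -hintegralE.
Unshelve. all: by end_near. Qed.

End H1_approximation.

(** * The weight *)

Section sech_dist.
Context (R : realType) (n : nat).
Local Notation mR := (measurableTypeR R).
Local Notation B := (@poincare_ball R n).
Implicit Types (x z v w : 'rV[R]_n).

(* This is 1 / cosh d(x,z), written so as to be smooth on the whole of R^n. *)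
Definition sech_dist z x : R := (1 - sqn x) * (1 - sqn z) *
  ((1 - sqn x) * (1 - sqn z) + 2 * sqn (x - z))^-1.

Lemma sqnB x z : sqn (x - z) = sqn x - 2 * dotr x z + sqn z.
Proof.
rewrite /sqn /dotr mulr_sumr -sumrN -!big_split/=; apply: eq_bigr => i _.
by rewrite !mxE; ring.
Qed.

(** Multiplied by 1 + |z|^2, the denominator equals |(1 + |z|^2) x - 2 z|^2 + (1 - |z|^2)^2. Only
    [z] has to lie in the ball; positivity for every [x] is what makes [sech_dist z] smooth on all
    of R^n. *)
Lemma sech_dist_den_gt0 z x : B z ->
  0 < (1 - sqn x) * (1 - sqn z) + 2 * sqn (x - z).
Proof.
rewrite /poincare_ball/= => z1.
have : 0 <= \sum_(i < n) ((1 + sqn z) * x ord0 i - 2 * z ord0 i) ^+ 2.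
  by apply: sumr_ge0 => i _; exact: sqr_ge0.
have -> A : \sum_(i < n) (A * x ord0 i - 2 * z ord0 i) ^+ 2 =
    A ^+ 2 * sqn x - 4 * A * dotr x z + 4 * sqn z.
  rewrite /sqn /dotr !mulr_sumr -sumrN -!big_split/=; apply: eq_bigr => i _.
  by ring.
have := sqn_ge0 z; rewrite sqnB; move: (sqn x) (sqn z) (dotr x z) z1 => X Z c Z1 Z0 h.
have Z2 : 0 < 1 + Z by lra.
rewrite -(pmulr_rgt0 _ Z2).
have : 0 < (1 - Z) ^+ 2 by rewrite exprn_gt0// subr_gt0.
by nra.
Qed.

Lemma smooth_sech_dist z : B z -> smooth (sech_dist z).
Proof.
move=> Bz; pose N x := (1 + (-1) * sqn x) * (1 - sqn z).
pose D x := N x + 2 * sqn (x - z).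
have CN : smooth N.
  apply: smoothM; last exact: smooth_cst.
  apply: smoothD; first exact: smooth_cst.
  by apply: smoothM; [exact: smooth_cst|exact: smooth_sqn0].
have CD : smooth D.
  apply: smoothD => //; apply: smoothM; first exact: smooth_cst.
  exact: smooth_sqn.
have D0 x : 0 < D x by have := sech_dist_den_gt0 x Bz; rewrite /D /N mulN1r.
rewrite (_ : sech_dist z = fun x => N x * D x `^ (-1)).
  by apply: smoothM => //; exact: smooth_powR.
apply/funext => x; rewrite powR_inv1; last exact: ltW.
by rewrite /D /N mulN1r.
Qed.

Lemma partial_sech_dist i z x : B z -> partial i (sech_dist z) x =
  - (4 * (1 - sqn z)) * (sqn (x - z) * x ord0 i + (1 - sqn x) * (x ord0 i - z ord0 i)) /
  ((1 - sqn x) * (1 - sqn z) + 2 * sqn (x - z)) ^+ 2.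
Proof.
move=> Bz; have D0 := sech_dist_den_gt0 x Bz.
have dN0 : differentiable (fun y => 1 - @sqn R n y) x.
  by apply: differentiableB; [exact: differentiable_cst|exact: differentiable_sqn].
have dN : differentiable (fun y => (1 - @sqn R n y) * (1 - sqn z)) x.
  by apply: differentiableM => //; exact: differentiable_cst.
have ds : differentiable (fun y => sqn (y - z)) x.
  by apply: smooth_differentiable; exact: smooth_sqn.
have ds2 : differentiable (fun y => 2 * sqn (y - z)) x.
  by apply: differentiableM => //; exact: differentiable_cst.
have dD : differentiable
    (fun y => (1 - @sqn R n y) * (1 - sqn z) + 2 * sqn (y - z)) x.
  exact: differentiableD.
have pN : partial i (fun y => (1 - @sqn R n y) * (1 - sqn z)) x =
    - (2 * x ord0 i) * (1 - sqn z).
  rewrite (partialM i dN0 (differentiable_cst (1 - sqn z) x)) partial_cst mulr0 add0r.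
  rewrite (partialB i (differentiable_cst (1 : R) x) (differentiable_sqn x)).
  by rewrite partial_cst partial_sqn0 sub0r mulrC.
have pD : partial i (fun y => (1 - @sqn R n y) * (1 - sqn z) + 2 * sqn (y - z)) x =
    - (2 * x ord0 i) * (1 - sqn z) + 2 * (2 * (x ord0 i - z ord0 i)).
  rewrite (partialD i dN ds2) pN (partialM i (differentiable_cst (2 : R) x) ds).
  by rewrite partial_cst mulr0 addr0 partial_sqn.
have dV : differentiable
    (fun y => ((1 - @sqn R n y) * (1 - sqn z) + 2 * sqn (y - z))^-1) x.
  by apply: differentiableV => //; exact: lt0r_neq0.
have pV : partial i
    (fun y => ((1 - @sqn R n y) * (1 - sqn z) + 2 * sqn (y - z))^-1) x =
    - ((1 - sqn x) * (1 - sqn z) + 2 * sqn (x - z)) ^- 2 *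
    partial i (fun y => (1 - @sqn R n y) * (1 - sqn z) + 2 * sqn (y - z)) x.
  apply: (@deriveV _ _ (fun y => (1 - @sqn R n y) * (1 - sqn z) + 2 * sqn (y - z))).
    exact: lt0r_neq0.
  exact: diff_derivable.
rewrite /sech_dist (partialM i dN dV) pV pN pD.
move: (sqn x) (sqn z) (sqn (x - z)) D0 => X Z s D0.
by field; exact: lt0r_neq0.
Qed.

Lemma sech_dist_gt0 z x : B z -> B x -> 0 < sech_dist z x.
Proof.
move=> Bz Bx; rewrite mulr_gt0 ?invr_gt0 ?sech_dist_den_gt0//.
by rewrite mulr_gt0// subr_gt0.
Qed.

Lemma sech_dist_le1 z x : B z -> B x -> sech_dist z x <= 1.
Proof.
move=> Bz Bx; rewrite /sech_dist -/(_ / _) ler_pdivrMr ?sech_dist_den_gt0// mul1r.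
by rewrite lerDl mulr_ge0// sqn_ge0.
Qed.

(* |grad cosh d| = sinh d <= cosh d. *)
Lemma hgrad_sech_dist_le z x : B z -> B x ->
  hgrad_dot x (gradient (sech_dist z) x) (gradient (sech_dist z) x) <=
  sech_dist z x ^+ 2.
Proof.
move=> Bz Bx; have D0 := sech_dist_den_gt0 x Bz.
rewrite hgrad_dotE.
have -> : dotr (gradient (sech_dist z) x) (gradient (sech_dist z) x) =
    (4 * (1 - sqn z)) ^+ 2 /
    ((1 - sqn x) * (1 - sqn z) + 2 * sqn (x - z)) ^+ 4 *
    (sqn (x - z) * ((1 - sqn x) * (1 - sqn z) + sqn (x - z))).
  transitivity ((4 * (1 - sqn z)) ^+ 2 /
    ((1 - sqn x) * (1 - sqn z) + 2 * sqn (x - z)) ^+ 4 *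
    \sum_(i < n) (sqn (x - z) * x ord0 i + (1 - sqn x) * (x ord0 i - z ord0 i)) ^+ 2).
    rewrite /dotr mulr_sumr; apply: eq_bigr => i _.
    rewrite !mxE partial_sech_dist//; move: (sqn x) (sqn z) (sqn (x - z)) D0 => X Z s D0.
    by field; exact: lt0r_neq0.
  congr (_ * _).
  have -> s a : \sum_(i < n) (s * x ord0 i + a * (x ord0 i - z ord0 i)) ^+ 2
      = s ^+ 2 * sqn x + 2 * s * a * (sqn x - dotr x z) + a ^+ 2 * sqn (x - z).
    rewrite /sqn /dotr mulrBr !mulr_sumr -sumrN -!big_split/=.
    by apply: eq_bigr => i _; rewrite !mxE; ring.
  by rewrite sqnB; ring.
have a0 : 0 < 1 - sqn x by rewrite subr_gt0.
have b0 : 0 < 1 - sqn z by rewrite subr_gt0.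
rewrite /sech_dist; move: (1 - sqn x) (1 - sqn z) (sqn (x - z)) D0 a0 b0 => a b s D0 a0 b0.
rewrite -subr_ge0.
(* Since |grad sech d| = sech d tanh d, the difference is exactly sech^4 d. *)
have -> : (a * b * (a * b + 2 * s)^-1) ^+ 2 -
   (a / 2) ^+ 2 * ((4 * b) ^+ 2 / (a * b + 2 * s) ^+ 4 * (s * (a * b + s))) =
   (a * b * (a * b) / (a * b + 2 * s) ^+ 2) ^+ 2.
  by field; exact: lt0r_neq0.
exact: sqr_ge0.
Qed.

End sech_dist.

Section weight.
Context (R : realType) (n : nat).
Local Notation mR := (measurableTypeR R).
Local Notation B := (@poincare_ball R n).
Implicit Types (x z : 'rV[R]_n) (dl beta : R).

Definition sech_sqr z1 z2 x : R := sech_dist z1 x ^+ 2 + sech_dist z2 x ^+ 2.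

(** [sech_sqr] vanishes on the unit sphere; the shift by [dl] keeps the base of the power positive
    on R^n, so that the weight is smooth and bounded there and its products with test functions are
    test functions. The exponent is halved because it is the square of the weight that enters the
    estimates. *)
Definition weight z1 z2 beta dl x : R :=
  (sech_sqr z1 z2 x + dl) `^ (- (beta / 2)).

Lemma sech_sqr_ge0 z1 z2 x : 0 <= sech_sqr z1 z2 x.
Proof. by rewrite addr_ge0 ?sqr_ge0. Qed.

Lemma sech_sqr_gt0 z1 z2 x : B z1 -> B x -> 0 < sech_sqr z1 z2 x.
Proof. by move=> Bz Bx; rewrite ltr_pwDl ?sqr_ge0// exprn_gt0// sech_dist_gt0. Qed.

Lemma smooth_sech_sqr z1 z2 : B z1 -> B z2 -> smooth (sech_sqr z1 z2).
Proof.
move=> B1 B2; rewrite (_ : sech_sqr z1 z2 = fun x =>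
  sech_dist z1 x * sech_dist z1 x + sech_dist z2 x * sech_dist z2 x).
  by apply: smoothD; apply: smoothM; exact: smooth_sech_dist.
by apply/funext => x; rewrite -!expr2.
Qed.

Lemma smooth_weight z1 z2 beta dl : B z1 -> B z2 -> 0 < dl ->
  smooth (weight z1 z2 beta dl).
Proof.
move=> B1 B2 dl0; apply: smooth_powR => [x|]; first by rewrite ltr_wpDl// sech_sqr_ge0.
by apply: smoothD; [exact: smooth_sech_sqr|exact: smooth_cst].
Qed.

Lemma weight_ge0 z1 z2 beta dl x : 0 <= weight z1 z2 beta dl x.
Proof. exact: powR_ge0. Qed.

Lemma weight_sqr z1 z2 beta dl x :
  weight z1 z2 beta dl x ^+ 2 = (sech_sqr z1 z2 x + dl) `^ (- beta).
Proof.
rewrite /weight -powR_mulrn ?powR_ge0// -powRrM; congr (_ `^ _).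
by rewrite mulNr -mulrA mulVf ?mulr1// pnatr_eq0.
Qed.

Lemma weight_le z1 z2 beta dl x : 0 < beta -> 0 < dl ->
  weight z1 z2 beta dl x <= dl `^ (- (beta / 2)).
Proof.
move=> b0 dl0; rewrite /weight !powRN lef_pV2 ?posrE ?powR_gt0//; last first.
  by rewrite ltr_wpDl// sech_sqr_ge0.
have S0 := sech_sqr_ge0 z1 z2 x.
have d0 := ltW dl0.
apply: ge0_ler_powR; first by rewrite divr_ge0// ltW.
- by rewrite nnegrE.
- by rewrite nnegrE addr_ge0.
- by rewrite lerDr.
Qed.

(** With [t = q1^2 + q2^2 + dl], the gradient is -[beta] (w / t) (q1 grad q1 + q2 grad q2).
    Cauchy-Schwarz, proved by Lagrange's identity in each coordinate, and |grad q_i| <= q_i bound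
    the squared norm of the last factor by (q1^2 + q2^2)^2 <= t^2. *)
Lemma hgrad_weight_le z1 z2 beta dl x : B z1 -> B z2 -> 0 < dl -> B x ->
  hgrad_dot x (gradient (weight z1 z2 beta dl) x) (gradient (weight z1 z2 beta dl) x)
  <= beta ^+ 2 * weight z1 z2 beta dl x ^+ 2.
Proof.
move=> B1 B2 dl0 Bx; set q1 := sech_dist z1; set q2 := sech_dist z2.
have t0 : 0 < sech_sqr z1 z2 x + dl by rewrite ltr_wpDl// sech_sqr_ge0.
set t := sech_sqr z1 z2 x + dl in t0.
have d1 : differentiable q1 x by apply: smooth_differentiable; exact: smooth_sech_dist.
have d2 : differentiable q2 x by apply: smooth_differentiable; exact: smooth_sech_dist.
have dt : differentiable (fun y => sech_sqr z1 z2 y + dl) x.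
  apply: differentiableD; last exact: differentiable_cst.
  by apply: smooth_differentiable; exact: smooth_sech_sqr.
have pE i : partial i (weight z1 z2 beta dl) x = - (beta / 2) *
   (weight z1 z2 beta dl x / t) * (2 * (q1 x * partial i q1 x + q2 x * partial i q2 x)).
  rewrite [LHS](partial_powR i _ dt t0) /weight -/t.
  rewrite powRB; last by apply/implyP => _; rewrite gt_eqF.
  rewrite powRr1; last exact: ltW.
  congr (_ * _); have ds : differentiable (sech_sqr z1 z2) x.
    by apply: smooth_differentiable; exact: smooth_sech_sqr.
  rewrite (partialD i ds (differentiable_cst dl x)) partial_cst addr0.
  rewrite [LHS](partialD i (differentiable_exprn 2 d1) (differentiable_exprn 2 d2)).
  by rewrite !partial_exprn//= !expr1; ring.
set w := weight z1 z2 beta dl x in pE *.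
have h1 := hgrad_sech_dist_le B1 Bx; have h2 := hgrad_sech_dist_le B2 Bx.
rewrite -/q1 -/q2 !hgrad_dotE in h1 h2 *.
set k := ((1 - sqn x) / 2) ^+ 2 in h1 h2 *; have k0 : 0 <= k by exact: sqr_ge0.
have le1 : dotr (gradient (weight z1 z2 beta dl) x) (gradient (weight z1 z2 beta dl) x) <=
    (beta * (w / t)) ^+ 2 * ((q1 x ^+ 2 + q2 x ^+ 2) *
    (dotr (gradient q1 x) (gradient q1 x) + dotr (gradient q2 x) (gradient q2 x))).
  rewrite /dotr -big_split/= !mulr_sumr; apply: ler_sum => i _; rewrite !mxE pE.
  move: (partial i q1 x) (partial i q2 x) (q1 x) (q2 x) (w / t) => a1 a2 b1 b2 s.
  rewrite -subr_ge0 (_ : _ - _ = (beta * s * (b1 * a2 - b2 * a1)) ^+ 2) ?sqr_ge0//.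
  by field.
apply: le_trans (ler_wpM2l k0 le1) _.
have S0 : 0 <= q1 x ^+ 2 + q2 x ^+ 2 by exact: sech_sqr_ge0.
have St : q1 x ^+ 2 + q2 x ^+ 2 <= t by rewrite lerDl ltW.
have -> : beta ^+ 2 * w ^+ 2 = (beta * (w / t)) ^+ 2 * t ^+ 2.
  by field; rewrite gt_eqF.
rewrite mulrCA; apply: ler_wpM2l; first exact: sqr_ge0.
move: (dotr _ _) (dotr _ _) (q1 x ^+ 2) (q2 x ^+ 2) h1 h2 S0 St => D1 D2 Q1 Q2 h1 h2 S0 St.
apply: (@le_trans _ _ ((Q1 + Q2) * (Q1 + Q2))); last by rewrite expr2 ler_pM.
by rewrite mulrCA ler_wpM2l// mulrDr lerD.
Qed.

End weight.

(** * Comparison of the bumps, the weight and the distance *)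

Section comparison.
Context (R : realType).

(** Each hypothesis gives q_i^2 <= 4 (W / c)^(2 / kappa), and the two add up to the factor 8. The
    halves come from sech d / 2 <= e^(-d). *)
Lemma weight_inv_bound (c kappa beta q1 q2 W : R) : 0 < c -> 0 < kappa -> 0 < beta ->
  0 < q1 -> 0 < q2 ->
  c * (q1 / 2) `^ kappa <= W -> c * (q2 / 2) `^ kappa <= W ->
  (W `^ (2 * (beta / kappa)))^-1 <=
  (8 * c^-1 `^ (2 / kappa)) `^ beta * (q1 ^+ 2 + q2 ^+ 2) `^ (- beta).
Proof.
move=> c0 k0 b0 q10 q20 h1 h2.
have W0 : 0 < W.
  by apply: lt_le_trans h1; rewrite mulr_gt0// powR_gt0// divr_gt0.
have q_le q : 0 < q -> c * (q / 2) `^ kappa <= W ->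
    q ^+ 2 <= 4 * (c^-1 `^ (2 / kappa) * W `^ (2 / kappa)).
  move=> q0; rewrite -ler_pdivlMl// => h.
  have q2p : 0 <= q / 2 by rewrite divr_ge0// ltW.
  have : ((q / 2) `^ kappa) `^ (2 / kappa) <= (c^-1 * W) `^ (2 / kappa).
    apply: ge0_ler_powR => //; first by rewrite divr_ge0// ltW.
      by rewrite nnegrE powR_ge0.
    by rewrite nnegrE mulr_ge0// ?invr_ge0 ltW.
  rewrite -powRrM mulrCA divff ?gt_eqF// mulr1 powR_mulrn//.
  rewrite powRM ?invr_ge0 ?(ltW c0) ?(ltW W0)// expr_div_n ler_pdivrMr// mulrC.
  by rewrite (_ : 2 ^+ 2 = 4 :> R)// -natrX.
have S0 : 0 < q1 ^+ 2 + q2 ^+ 2 by rewrite addr_gt0// exprn_gt0.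
have S_le : q1 ^+ 2 + q2 ^+ 2 <= 8 * c^-1 `^ (2 / kappa) * W `^ (2 / kappa).
  by have := q_le _ q10 h1; have := q_le _ q20 h2; rewrite -mulrA; lra.
rewrite powRN ler_pdivlMr ?powR_gt0// mulrC ler_pdivrMr ?powR_gt0//.
have -> : 2 * (beta / kappa) = 2 / kappa * beta by ring.
rewrite [W `^ _]powRrM -powRM ?powR_ge0//; last by rewrite mulr_ge0// powR_ge0.
apply: ge0_ler_powR => //; first exact: ltW.
  by rewrite nnegrE ltW.
by rewrite nnegrE (le_trans _ S_le)// ltW.
Qed.

(* Where W is small, m W^(p-1) <= eta; elsewhere t is bounded below. *)
Lemma potential_absorption (C kappa beta p m eta : R) :
  0 < C -> 0 < kappa -> 0 < beta -> 1 < p -> 0 < m -> 0 < eta ->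
  exists2 K : R, 0 <= K & forall t W, 0 < t -> 0 < W -> W <= C * t `^ (kappa / 2) ->
    m * (W `^ (p - 1) * t `^ (- beta)) <= eta * t `^ (- beta) + K * W `^ (p - 1).
Proof.
move=> C0 k0 b0 p1 m0 eta0.
have p0 : 0 < p - 1 by rewrite subr_gt0.
(* The threshold [d] solves m d^(p-1) = eta, and [t0] below solves C t0^(kappa/2) = d; hence [W > d]
   forces [t >= t0], which explains the constant m t0^(-beta). *)
pose d := (eta / m) `^ (p - 1)^-1.
have d0 : 0 < d by rewrite powR_gt0// divr_gt0.
pose t0 := (d / C) `^ (2 / kappa).
have t00 : 0 < t0 by rewrite powR_gt0// divr_gt0.
exists (m * t0 `^ (- beta)); first by rewrite mulr_ge0 ?powR_ge0// ltW.
move=> t W t_gt0 W0 Wt; have [Wd|dW] := leP W d.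
  have : W `^ (p - 1) <= eta / m.
    rewrite -[leRHS](_ : d `^ (p - 1) = _); last first.
      by rewrite /d -powRrM mulVf ?gt_eqF// powRr1// divr_ge0// ltW.
    by apply: ge0_ler_powR; rewrite ?nnegrE// ltW.
  rewrite ler_pdivlMr// mulrC => h.
  rewrite mulrA -[leLHS]addr0 lerD//; first by rewrite ler_wpM2r// powR_ge0.
  by rewrite mulr_ge0 ?powR_ge0// mulr_ge0 ?powR_ge0// ltW.
have tt0 : t0 <= t.
  have : d / C <= t `^ (kappa / 2).
    by rewrite ler_pdivrMr// mulrC; exact: le_trans (ltW dW) Wt.
  move=> h; rewrite -[leRHS](_ : (t `^ (kappa / 2)) `^ (2 / kappa) = t); last first.
    rewrite -powRrM (_ : kappa / 2 * (2 / kappa) = 1); first by rewrite powRr1// ltW.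
    by field; rewrite gt_eqF.
  have dC : 0 < d / C by rewrite divr_gt0.
  by apply: ge0_ler_powR => //; rewrite ?nnegrE ?powR_ge0 ?divr_ge0// ltW.
have : t `^ (- beta) <= t0 `^ (- beta).
  rewrite !powRN lef_pV2; try by rewrite posrE; exact: powR_gt0.
  by apply: ge0_ler_powR => //; rewrite ?nnegrE ltW.
move=> h; rewrite -[leLHS]add0r lerD//.
  by rewrite mulr_ge0 ?powR_ge0// ltW.
by rewrite -mulrA ler_pM2l// mulrC ler_wpM2r// powR_ge0.
Qed.

End comparison.

Section hdist_comparison.
Context (R : realType) (n : nat).
Local Notation mR := (measurableTypeR R).
Local Notation B := (@poincare_ball R n).
Implicit Types (x z : 'rV[R]_n).

(** Here [rho] is cosh d(x,z) and its sum with the square root is e^d, which therefore lies between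
    cosh d and 2 cosh d: exponential decay in d can be read as a power of [sech_dist]. *)
Lemma exp_hdist z x : B z -> B x -> let rho := (sech_dist z x)^-1 in
  [/\ 1 <= rho, hdist x z = ln (rho + Num.sqrt (rho ^+ 2 - 1)) &
      rho <= rho + Num.sqrt (rho ^+ 2 - 1) <= 2 * rho].
Proof.
move=> Bz Bx rho.
have a0 : 0 < 1 - sqn x by rewrite subr_gt0.
have b0 : 0 < 1 - sqn z by rewrite subr_gt0.
have D0 := sech_dist_den_gt0 x Bz.
have rhoE : rho = 1 + 2 * sqn (x - z) / ((1 - sqn x) * (1 - sqn z)).
  rewrite /rho /sech_dist; move: (1 - sqn x) (1 - sqn z) a0 b0 D0 => a b a0 b0 D0.
  by field; rewrite !gt_eqF.
have rho1 : 1 <= rho.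
  by rewrite rhoE lerDl divr_ge0 ?mulr_ge0 ?sqn_ge0// ltW// mulr_gt0.
split => //; first by rewrite /hdist /arcosh rhoE.
have rho0 : 0 <= rho by exact: le_trans rho1.
apply/andP; split; first by rewrite lerDl sqrtr_ge0.
rewrite mulr_natl mulr2n lerD2l -[leRHS]ger0_norm// -sqrtr_sqr ler_wsqrtr//.
by rewrite gerBl.
Qed.

Lemma hdist_ge0 z x : B z -> B x -> 0 <= hdist x z.
Proof.
move=> Bz Bx; have [rho1 -> /andP[h _]] := exp_hdist Bz Bx.
by rewrite ln_ge0//; exact: le_trans h.
Qed.

Lemma expR_hdist_bounds kappa z x : 0 < kappa -> B z -> B x ->
  (sech_dist z x / 2) `^ kappa <= expR (- (kappa * hdist x z)) <=
  sech_dist z x `^ kappa.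
Proof.
move=> k0 Bz Bx; have [rho1 -> ] := exp_hdist Bz Bx.
have q0 := sech_dist_gt0 Bz Bx.
set y := _ + _ => /andP[h1 h2].
have rho0 : 0 < (sech_dist z x)^-1 by rewrite invr_gt0.
have y0 : 0 < y by exact: lt_le_trans h1.
have -> : expR (- (kappa * ln y)) = y^-1 `^ kappa.
  rewrite -mulrN -lnV ?posrE// /powR ifF//.
  by apply/negbTE; rewrite gt_eqF// invr_gt0.
have q2 : 0 < sech_dist z x / 2 by rewrite divr_gt0.
have k0' := ltW k0; have q2' := ltW q2; have q0' := ltW q0; have y0' := ltW y0.
apply/andP; split; apply: ge0_ler_powR; rewrite ?nnegrE ?invr_ge0//.
  rewrite -[leLHS]invrK lef_pV2 ?posrE ?invr_gt0//.
  by rewrite invf_div.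
by rewrite invf_ple ?posrE.
Qed.

Lemma measurable_hdist z : B z ->
  measurable_fun B ((fun x => hdist x z) : 'rV[mR]_n -> mR).
Proof.
move=> Bz.
have mrho : hmeasurable (fun x => (sech_dist z x)^-1).
  apply: open_continuous_measurable_fun_rV; first exact: open_poincare_ball.
  move=> x; rewrite inE => Bx; apply: differentiable_continuous.
  apply: differentiableV; last by rewrite gt_eqF// sech_dist_gt0.
  by apply: smooth_differentiable; exact: smooth_sech_dist.
rewrite (_ : measurable_fun B _ = measurable_fun B
  ((fun x => ln ((sech_dist z x)^-1 + Num.sqrt ((sech_dist z x)^-1 ^+ 2 - 1))) :
   'rV[mR]_n -> mR)); last first.
  apply/propeqP; split; apply: eq_measurable_fun => x; rewrite inE => Bx;
  by have [_ ->] := exp_hdist Bz Bx.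
apply: (measurableT_comp (@measurable_ln R)).
apply: measurable_funD => //.
apply: (measurableT_comp (f := @Num.sqrt R)).
  by apply: continuous_measurable_fun; exact: sqrt_continuous.
apply: measurable_funB; last exact: measurable_cst.
exact: measurable_funX.
Qed.

(** The profile [u] is continuous on the half-line only, which is where [hdist] takes its values. *)
Lemma measurable_translate (u : R -> R) z : {within `[0, +oo[, continuous u} ->
  B z -> hmeasurable (translate u z).
Proof.
move=> cu Bz; apply: (@measurable_comp _ _ _ _ mR mR (`[0, +oo[%classic : set R) u B
  (fun x => hdist x z)) => //.
- move=> _ [x Bx <-] /=; rewrite in_itv/= andbT; exact: hdist_ge0.
- by apply: subspace_continuous_measurable_fun.
- exact: measurable_hdist.
Qed.

End hdist_comparison.

(** * The energy estimate *)

Section young.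
Context (R : realType).

(* With [D = G - g] and [u = w g + f h], the difference of the two sides is
   [(2 t u + w D)^2 / (4 t) + (2 t f h + w D)^2 / (4 t)]. *)
Lemma young_gradient (t w f g h G : R) : 0 < t ->
  (1 - t) * (w * g + f * h) ^+ 2 - (1 + t) * (f ^+ 2 * h ^+ 2)
    - w ^+ 2 / (2 * t) * (g - G) ^+ 2 <=
  G * (w * (w * g + f * h) + w * f * h).
Proof.
move=> t0; have t4 : 0 < 4 * t by rewrite mulr_gt0.
rewrite -subr_ge0 [X in 0 <= X](_ : _ = (2 * t * (w * g + f * h) + w * (G - g)) ^+ 2 / (4 * t) +
   (2 * t * (f * h) + w * (G - g)) ^+ 2 / (4 * t)).
  by rewrite addr_ge0// divr_ge0 ?sqr_ge0// ltW.
by field; rewrite gt_eqF.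
Qed.

(** With [d = f - psi], the right-hand side is -(lambda + mu V) (w f)^2 plus the cross term (lambda
    + mu V) w^2 f d. Young's inequality charges the cross term to [t] (w f)^2 and to d^2. The
    potential is absorbed up to K V f^2, and f^2 <= 2 psi^2 + 2 d^2 then brings in psi^2 V, the
    integrand that is normalised. The size of [mu] is felt only through [L2], in front of d^2. *)
Lemma young_potential (t lambda mu m eta V w f psi K CV Cw L2 : R) :
  0 < t -> 0 <= V -> V <= CV -> 0 <= K -> w ^+ 2 <= Cw -> mu <= m ->
  `|lambda| + `|mu| * CV <= L2 ->
  m * (V * w ^+ 2) <= eta * w ^+ 2 + K * V ->
  - (lambda + t + eta) * (w * f) ^+ 2 - 2 * K * (psi ^+ 2 * V)
    - (Cw * (L2 ^+ 2 / (4 * t)) + 2 * K * CV) * (f - psi) ^+ 2 <=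
  - (lambda * psi * (w ^+ 2 * f)) - mu * V * psi * (w ^+ 2 * f).
Proof.
move=> t0 V0 VC K0 wC mum L2P abs.
have t4 : 0 < 4 * t by rewrite mulr_gt0.
have L2lm : (lambda + mu * V) ^+ 2 <= L2 ^+ 2.
  rewrite -[leLHS]real_normK ?num_real// ler_sqr ?nnegrE ?normr_ge0//; last first.
    by apply: le_trans L2P; rewrite addr_ge0// mulr_ge0// (le_trans V0).
  apply: le_trans (ler_normD _ _) (le_trans _ L2P); rewrite lerD2l normrM ler_wpM2l//.
  by rewrite ger0_norm.
pose d := f - psi.
have w0 := sqr_ge0 w.
have h1 : - (t * (w * f) ^+ 2) - Cw * (L2 ^+ 2 / (4 * t)) * d ^+ 2 <=
    (lambda + mu * V) * w ^+ 2 * f * d.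
  apply: (@le_trans _ _ (- (t * (w * f) ^+ 2)
    - w ^+ 2 * ((lambda + mu * V) ^+ 2 / (4 * t)) * d ^+ 2)).
    rewrite lerB// ler_wpM2r ?sqr_ge0// ler_pM ?divr_ge0 ?sqr_ge0 ?(ltW t4)//.
    by rewrite ler_wpM2r// invr_ge0 ltW.
  rewrite -subr_ge0 [X in 0 <= X](_ : _ =
    w ^+ 2 * ((2 * t * f + (lambda + mu * V) * d) ^+ 2 / (4 * t))).
    by apply: mulr_ge0 => //; apply: divr_ge0; [exact: sqr_ge0|exact: ltW].
  by field; rewrite gt_eqF.
have h2 : mu * V * (w * f) ^+ 2 <= eta * (w * f) ^+ 2 + K * V * f ^+ 2.
  apply: (@le_trans _ _ (m * (V * w ^+ 2) * f ^+ 2)).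
    rewrite [leLHS](_ : _ = mu * (V * w ^+ 2) * f ^+ 2); last by ring.
    by apply: ler_wpM2r; [exact: sqr_ge0|apply: ler_wpM2r => //; exact: mulr_ge0].
  apply: le_trans (ler_wpM2r (sqr_ge0 f) abs) _.
  by rewrite [leLHS](_ : _ = eta * (w * f) ^+ 2 + K * V * f ^+ 2)//; ring.
have h3 : K * V * f ^+ 2 <= 2 * K * (psi ^+ 2 * V) + 2 * K * CV * d ^+ 2.
  apply: (@le_trans _ _ (K * V * (2 * psi ^+ 2 + 2 * d ^+ 2))).
    rewrite ler_wpM2l ?mulr_ge0// -subr_ge0.
    by rewrite [X in 0 <= X](_ : _ = (psi - d) ^+ 2) ?sqr_ge0// /d; ring.
  rewrite -subr_ge0 [X in 0 <= X](_ : _ = 2 * K * (CV - V) * d ^+ 2); last by ring.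
  apply: mulr_ge0; last exact: sqr_ge0.
  by apply: mulr_ge0; [exact: mulr_ge0|rewrite subr_ge0].
have -> : - (lambda * psi * (w ^+ 2 * f)) - mu * V * psi * (w ^+ 2 * f) =
   - lambda * (w * f) ^+ 2 - mu * V * (w * f) ^+ 2 + (lambda + mu * V) * w ^+ 2 * f * d.
  by rewrite /d; ring.
rewrite -/d; move: h1 h2 h3; move: (d ^+ 2) (_ * _ * f * d) (mu * V * _).
by move=> d2 A E h1 h2 h3; lra.
Qed.

End young.

Section energy.
Context (R : realType) (n : nat).
Local Notation mR := (measurableTypeR R).
Local Notation B := (@poincare_ball R n).
Implicit Types (x : 'rV[R]_n) (f g w phi Psi V : 'rV[R]_n -> R).

Lemma hintegrableM f g : hmeasurable f -> hmeasurable g ->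
  hintegrable (fun x => f x ^+ 2) -> hintegrable (fun x => g x ^+ 2) ->
  hintegrable (fun x => f x * g x).
Proof.
move=> mf mg f2 g2; apply: (hintegrable_le _ (hintegrableD f2 g2)) => [|x _].
  exact: measurable_funM.
rewrite ler_norml; have := sqr_ge0 (f x + g x); have := sqr_ge0 (f x - g x).
have := sqr_ge0 (f x); have := sqr_ge0 (g x).
by move: (f x) (g x) => a b; rewrite !sqrrD; nra.
Qed.

Lemma hgrad_dot_le (x v w : 'rV[R]_n) :
  `|hgrad_dot x v w| <= hgrad_dot x v v + hgrad_dot x w w.
Proof.
rewrite !hgrad_dotE -mulrDr normrM ger0_norm ?sqr_ge0// ler_wpM2l ?sqr_ge0//.
rewrite /dotr -big_split; apply: le_trans (ler_norm_sum _ _ _) _.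
apply: ler_sum => i _ /=; rewrite ler_norml.
have := sqr_ge0 (v ord0 i + w ord0 i); have := sqr_ge0 (v ord0 i - w ord0 i).
have := sqr_ge0 (v ord0 i); have := sqr_ge0 (w ord0 i).
by move: (v ord0 i) (w ord0 i) => a b; rewrite !sqrrD; nra.
Qed.

(** [A] and [F] stand for the two sides of the weak equation, whose integrals cancel. Of the five
    terms, the first two carry grad (w phi) and w phi, the third the normalisation, and the last two
    the approximation errors. *)
Lemma hRint_lower_bound (A F E1 E2 E3 E4 E5 : 'rV[R]_n -> R) (a c k P Q : R) :
  hintegrable A -> hintegrable F -> hRint A = hRint F ->
  hintegrable E1 -> hintegrable E2 -> hintegrable E3 -> hintegrable E4 ->
  hintegrable E5 ->
  (forall x, B x ->
    a * E1 x - c * E2 x - k * E3 x - P * E4 x - Q * E5 x <= A x - F x) ->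
  a * hRint E1 <= c * hRint E2 + k * hRint E3 + P * hRint E4 + Q * hRint E5.
Proof.
move=> iA iF AF i1 i2 i3 i4 i5 le.
have j1 := hintegrableZ a i1; have j2 := hintegrableZ c i2.
have j3 := hintegrableZ k i3; have j4 := hintegrableZ P i4.
have j5 := hintegrableZ Q i5.
have j12 := hintegrableB j1 j2; have j13 := hintegrableB j12 j3.
have j14 := hintegrableB j13 j4; have j15 := hintegrableB j14 j5.
have := hRint_le j15 (hintegrableB iA iF) le.
rewrite (hRintB iA iF) AF subrr (hRintB j14 j5) (hRintB j13 j4) (hRintB j12 j3).
rewrite (hRintB j1 j2) (hRintZ a i1) (hRintZ c i2) (hRintZ k i3).
rewrite (hRintZ P i4) (hRintZ Q i5).
move: (a * _) (c * _) (k * _) (P * _) (Q * _); clear=> *; lra.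
Qed.

Lemma smooth_sqr f : smooth f -> smooth (fun x => f x ^+ 2).
Proof. by move=> Cf; exact: (smoothM Cf Cf). Qed.

(** For [G = grad f] one has the identity grad f . grad(w^2 f) = |grad(w f)|^2 - f^2 |grad w|^2. For
    another [G] it survives as an inequality, with factors [1 - t] and [1 + t] and an error in |grad
    f - G|^2: this is [young_gradient] summed over the coordinates. *)
Lemma gradient_lower_bound (t beta Cw : R) w f (x G : 'rV[R]_n) : 0 < t -> smooth w -> smooth f ->
  w x ^+ 2 <= Cw ->
  hgrad_dot x (gradient w x) (gradient w x) <= beta ^+ 2 * w x ^+ 2 ->
  (1 - t) * hgrad_dot x (gradient (fun y => w y * f y) x) (gradient (fun y => w y * f y) x)
  - (1 + t) * beta ^+ 2 * (w x * f x) ^+ 2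
  - Cw / (2 * t) * hgrad_dot x (gradient f x - G) (gradient f x - G) <=
  hgrad_dot x G (gradient (fun y => w y ^+ 2 * f y) x).
Proof.
move=> t0 Cw_ Cf wC hw.
apply: (@le_trans _ _ ((1 - t) *
    hgrad_dot x (gradient (fun y => w y * f y) x) (gradient (fun y => w y * f y) x)
  - (1 + t) * (f x ^+ 2 * hgrad_dot x (gradient w x) (gradient w x))
  - w x ^+ 2 / (2 * t) * hgrad_dot x (gradient f x - G) (gradient f x - G))).
  apply: lerB; last first.
    apply: ler_wpM2r; first exact: hgrad_dot_ge0.
    by apply: ler_wpM2r => //; rewrite invr_ge0 ltW// mulr_gt0.
  rewrite lerD2l lerN2 [leRHS](_ : _ = (1 + t) * (f x ^+ 2 * (beta ^+ 2 * w x ^+ 2))).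
    apply: ler_wpM2l; first by rewrite addr_ge0// ltW.
    by apply: ler_wpM2l => //; exact: sqr_ge0.
  by ring.
rewrite !hgrad_dotE; set k := ((1 - sqn x) / 2) ^+ 2.
have k0 : 0 <= k by exact: sqr_ge0.
rewrite [leLHS](_ : _ = k * ((1 - t) *
    dotr (gradient (fun y => w y * f y) x) (gradient (fun y => w y * f y) x)
  - (1 + t) * (f x ^+ 2 * dotr (gradient w x) (gradient w x))
  - w x ^+ 2 / (2 * t) * dotr (gradient f x - G) (gradient f x - G))); last by ring.
apply: ler_wpM2l => //.
rewrite /dotr !mulr_sumr -!sumrB; apply: ler_sum => i _.
have dw : differentiable w x by exact: smooth_differentiable.
have df : differentiable f x by exact: smooth_differentiable.
rewrite !mxE partialM// partialM//; last exact: smooth_differentiable (smooth_sqr Cw_).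
rewrite partial_exprn//= expr1.
have := young_gradient (w x) (f x) (partial i f x) (partial i w x) (G ord0 i) t0.
move: (w x) (f x) (partial i f x) (partial i w x) (G ord0 i) => w1 f1 g1 h1 G1 h.
rewrite [leLHS](_ : _ = (1 - t) * (w1 * g1 + f1 * h1) ^+ 2 - (1 + t) * (f1 ^+ 2 * h1 ^+ 2)
    - w1 ^+ 2 / (2 * t) * (g1 - G1) ^+ 2); last by ring.
by rewrite [leRHS](_ : _ = G1 * (w1 * (w1 * g1 + f1 * h1) + w1 * f1 * h1))//; ring.
Qed.

End energy.

Section energy_estimate.
Context (R : realType) (n : nat).
Local Notation mR := (measurableTypeR R).
Local Notation B := (@poincare_ball R n).
Implicit Types (x : 'rV[R]_n).

Lemma hintegrable_sqr_test (phi : 'rV[R]_n -> R) : test_function phi ->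
  hintegrable (fun x => phi x ^+ 2).
Proof.
move=> tphi; apply: (hintegrable_test tphi) => [x|x /nbhs_singleton ->].
  exact/smooth_continuous/smooth_sqr/test_smooth.
by rewrite expr0n.
Qed.

(** A single approximant suffices, as [G = grad phi - (grad phi - G)]. *)
Lemma hintegrable_grad (phi : 'rV[R]_n -> R) (G : 'rV[R]_n -> 'rV[R]_n) :
  test_function phi -> measurable_fun B (G : 'rV[mR]_n -> 'rV[mR]_n) ->
  hintegrable (fun x => hgrad_dot x (gradient phi x - G x) (gradient phi x - G x)) ->
  hintegrable (fun x => hgrad_dot x (G x) (G x)).
Proof.
move=> tphi mG iD.
have mGi i : hmeasurable (fun x => G x ord0 i).
  exact: measurableT_comp (measurable_coord i) mG.
apply: (hintegrable_le _ (hintegrableD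
  (hintegrableZ 2 (hintegrable_hgrad_test tphi)) (hintegrableZ 2 iD))) => [|x _].
  exact: hmeasurable_hgrad_dot.
rewrite ger0_norm ?hgrad_dot_ge0//.
have := hgrad_dotB_le x (gradient phi x) (gradient phi x - G x).
by rewrite opprB addrC subrK.
Qed.

Lemma hintegrable_sqr_approx (phi Psi : 'rV[R]_n -> R) :
  test_function phi -> hmeasurable Psi ->
  hintegrable (fun x => (phi x - Psi x) ^+ 2) -> hintegrable (fun x => Psi x ^+ 2).
Proof.
move=> tphi mPsi id.
apply: (hintegrable_le _ (hintegrableD
  (hintegrableZ 2 (hintegrable_sqr_test tphi)) (hintegrableZ 2 id))) => [|x _].
  exact: measurable_funX.
rewrite ger0_norm ?sqr_ge0//; move: (phi x) (Psi x); clear=> a b.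
rewrite -subr_ge0 [X in 0 <= X](_ : _ = (2 * a - b) ^+ 2) ?sqr_ge0//; ring.
Qed.

Lemma hintegrable_weak_lhs (lambda : R) (psi Psi : 'rV[R]_n -> R) G :
  test_function psi -> hmeasurable Psi ->
  measurable_fun B (G : 'rV[mR]_n -> 'rV[mR]_n) ->
  hintegrable (fun x => hgrad_dot x (G x) (G x)) ->
  hintegrable (fun x => Psi x ^+ 2) ->
  hintegrable (fun x => hgrad_dot x (G x) (gradient psi x) - lambda * Psi x * psi x).
Proof.
move=> tpsi mPsi mG iG iPsi.
have mpsi : hmeasurable psi by apply: hmeasurable_smooth; exact: test_smooth.
have iP := hintegrableM mPsi mpsi iPsi (hintegrable_sqr_test tpsi).
have iE : hintegrable (fun x => hgrad_dot x (G x) (gradient psi x)).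
  apply: (hintegrable_le _ (hintegrableD iG (hintegrable_hgrad_test tpsi))) => [|x _].
    apply: hmeasurable_hgrad_dot => i.
      exact: measurableT_comp (measurable_coord i) mG.
    under eq_fun do rewrite mxE.
    by apply: hmeasurable_smooth; apply: smooth_partial; exact: test_smooth.
  exact: hgrad_dot_le.
have := hintegrableB iE (hintegrableZ lambda iP).
by congr hintegrable; apply/funext => x; rewrite mulrA.
Qed.

Lemma hintegrable_weak_rhs (mu CV : R) (psi Psi V : 'rV[R]_n -> R) :
  test_function psi -> hmeasurable Psi -> hmeasurable V ->
  (forall x, B x -> 0 <= V x) -> (forall x, B x -> V x <= CV) ->
  hintegrable (fun x => Psi x ^+ 2) ->
  hintegrable (fun x => mu * V x * Psi x * psi x).
Proof.
move=> tpsi mPsi mV V0 VC iPsi.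
have mpsi : hmeasurable psi by apply: hmeasurable_smooth; exact: test_smooth.
apply: (hintegrable_le _ (hintegrableZ (`|mu| * CV)
  (hintegrableD iPsi (hintegrable_sqr_test tpsi)))) => [|x Bx].
  apply: measurable_funM => //; apply: measurable_funM => //.
  exact: measurable_funM.
rewrite -mulrA normrM; apply: ler_pM => //.
  rewrite normrM; apply: ler_wpM2l => //.
  by rewrite ger0_norm ?V0 ?VC.
rewrite ler_norml; move: (Psi x) (psi x); clear=> a b.
have := sqr_ge0 (a + b); have := sqr_ge0 (a - b).
by have := sqr_ge0 a; have := sqr_ge0 b; rewrite !sqrrD; nra.
Qed.

(* The weak equation is tested against w^2 phi, with phi an approximation of Psi. *)
Lemma energy_step (lambda mu m t beta eta K CV Cw : R) (w V Psi phi : 'rV[R]_n -> R) G :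
  (0 < n)%N -> 0 < t -> t < 1 -> 0 <= K -> mu <= m ->
  smooth w -> (forall x, B x -> w x ^+ 2 <= Cw) ->
  (forall x, B x -> hgrad_dot x (gradient w x) (gradient w x) <=
    beta ^+ 2 * w x ^+ 2) ->
  hmeasurable V -> (forall x, B x -> 0 <= V x) -> (forall x, B x -> V x <= CV) ->
  (forall x, B x -> m * (V x * w x ^+ 2) <= eta * w x ^+ 2 + K * V x) ->
  hmeasurable Psi -> measurable_fun B (G : 'rV[mR]_n -> 'rV[mR]_n) ->
  (forall psi, test_function psi ->
    hintegral (fun x => hgrad_dot x (G x) (gradient psi x) - lambda * Psi x * psi x) =
    hintegral (fun x => mu * V x * Psi x * psi x)) ->
  hintegrable (fun x => Psi x ^+ 2 * V x) ->
  test_function phi ->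
  hintegrable (fun x => hgrad_dot x (gradient phi x - G x) (gradient phi x - G x)) ->
  hintegrable (fun x => (phi x - Psi x) ^+ 2) ->
  ((1 - t) * ((n%:R - 1) / 2) ^+ 2 - (lambda + t + eta + (1 + t) * beta ^+ 2)) *
    hRint (fun x => (w x * phi x) ^+ 2) <=
  2 * K * hRint (fun x => Psi x ^+ 2 * V x) +
  Cw / (2 * t) *
    hRint (fun x => hgrad_dot x (gradient phi x - G x) (gradient phi x - G x)) +
  (Cw * ((`|lambda| + `|mu| * CV) ^+ 2 / (4 * t)) + 2 * K * CV) *
    hRint (fun x => (phi x - Psi x) ^+ 2).
Proof.
move=> n0 t0 t1 K0 mum Cw_ wC hw mV V0 VC abs mPsi mG weak iPV tphi iD id.
pose psi x := w x ^+ 2 * phi x.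
have tpsi : test_function psi by exact: test_functionM (smooth_sqr Cw_) tphi.
have iPsi := hintegrable_sqr_approx tphi mPsi id.
have iG := hintegrable_grad tphi mG iD.
have iA := hintegrable_weak_lhs lambda tpsi mPsi mG iG iPsi.
have iF := hintegrable_weak_rhs mu tpsi mPsi mV V0 VC iPsi.
have AF := congr1 fine (weak psi tpsi).
have tu := test_functionM Cw_ tphi.
have iu := hintegrable_sqr_test tu.
have := hRint_lower_bound (a := 1 - t) (c := lambda + t + eta + (1 + t) * beta ^+ 2)
  (k := 2 * K) (P := Cw / (2 * t))
  (Q := Cw * ((`|lambda| + `|mu| * CV) ^+ 2 / (4 * t)) + 2 * K * CV)
  iA iF AF (hintegrable_hgrad_test tu) iu iPV iD id.
have poinc := poincare_inequality n0 tu.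
have t1' : 0 <= 1 - t by rewrite subr_ge0 ltW.
(* The Poincare inequality for the test function [w phi] converts the gradient term into a multiple
   of the integral of (w phi)^2; [t < 1] keeps its coefficient nonnegative. *)
have := ler_wpM2l t1' poinc; rewrite mulrA.
set I1 := hRint _; set I2 := hRint _; set I3 := hRint _; set I4 := hRint _; set I5 := hRint _.
move=> h1 h2; rewrite mulrBl lerBlDl.
apply: (le_trans h1); rewrite !addrA; apply: h2 => x Bx.
have g1 := gradient_lower_bound (G x) t0 Cw_ (test_smooth tphi) (wC x Bx) (hw x Bx).
have g2 := young_potential (lambda := lambda) (phi x) (Psi x) t0 (V0 x Bx) (VC x Bx)
  K0 (wC x Bx) mum (lexx _) (abs x Bx).
rewrite /psi; move: g1 g2.
move: (hgrad_dot x (gradient (fun y => w y * phi y) x) _)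
  (hgrad_dot x (gradient phi x - G x) _) (hgrad_dot x (G x) _) => H1 H4 HG.
move: (Cw / (2 * t)) (Cw * (_ / (4 * t))) => P Q0.
clear; move: (w x) (phi x) (Psi x) (V x) => w0 f0 p0 v0 g1 g2.
have := lerD g1 g2; rewrite -subr_ge0 => h; rewrite -subr_ge0.
by apply: le_trans h _; rewrite le_eqVlt; apply/orP; left; apply/eqP; ring.
Qed.

End energy_estimate.

Section energy_limit.
Context (R : realType) (n : nat).
Local Notation mR := (measurableTypeR R).
Local Notation B := (@poincare_ball R n).
Implicit Types (x : 'rV[R]_n).

(** [Cw], [CV] and [|mu|] are absent from the bound because they multiply only approximation errors,
    which one good approximant makes as small as desired. The factor 4 is 2 times 2: one from f^2 <=
    2 psi^2 + 2 d^2 in the potential term, the other from returning from [w phi] to [w Psi]. *)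
Lemma energy_estimate (lambda mu m t beta eta K CV Cw gam : R) (w V Psi : 'rV[R]_n -> R) :
  (1 < n)%N -> 0 < t -> t < 1 -> 0 <= K -> 0 <= CV -> 0 <= Cw -> mu <= m -> 0 < gam ->
  gam <= (1 - t) * ((n%:R - 1) / 2) ^+ 2 - (lambda + t + eta + (1 + t) * beta ^+ 2) ->
  smooth w -> (forall x, B x -> w x ^+ 2 <= Cw) ->
  (forall x, B x -> hgrad_dot x (gradient w x) (gradient w x) <=
    beta ^+ 2 * w x ^+ 2) ->
  hmeasurable V -> (forall x, B x -> 0 <= V x) -> (forall x, B x -> V x <= CV) ->
  (forall x, B x -> m * (V x * w x ^+ 2) <= eta * w x ^+ 2 + K * V x) ->
  H1_solution lambda (fun x => mu * V x * Psi x) Psi ->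
  hintegral (fun x => Psi x ^+ 2 * V x) = 1%E ->
  (hintegral (fun x => (w x ^+ 2 * Psi x ^+ 2)%R) <= (4 * K / gam)%:E)%E.
Proof.
move=> n1 t0 t1 K0 CV0 Cw0 mum gam0 gamP Cw_ wC hw mV V0 VC abs.
move=> [G [mPsi mG [phi_ [tphi phiG phiPsi]]] weak] norm1.
have iPV : hintegrable (fun x => Psi x ^+ 2 * V x).
  apply: ge0_hintegrable => [|x Bx|]; last by rewrite norm1 ltry.
    by apply: measurable_funM => //; exact: measurable_funX.
  by rewrite mulr_ge0 ?sqr_ge0 ?V0.
have norm1' : hRint (fun x => Psi x ^+ 2 * V x) = 1 by rewrite /hRint norm1.
pose P := Cw / (2 * t).
pose Q := Cw * ((`|lambda| + `|mu| * CV) ^+ 2 / (4 * t)) + 2 * K * CV.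
have P0 : 0 <= P by apply: divr_ge0 => //; rewrite mulr_ge0// ltW.
have Q0 : 0 <= Q.
  apply: addr_ge0; last by rewrite !mulr_ge0.
  by apply: mulr_ge0 => //; apply: divr_ge0; [exact: sqr_ge0|rewrite mulr_ge0// ltW].
have mw : hmeasurable w by exact: hmeasurable_smooth.
have approx := H1_gradient_approx n1 mPsi mG tphi phiG phiPsi.
have mwP : hmeasurable (fun x => w x ^+ 2 * Psi x ^+ 2).
  by apply: measurable_funM; exact: measurable_funX.
have iwP : hintegrable (fun x => w x ^+ 2 * Psi x ^+ 2).
  have [k _ /(_ k (leqnn k)) [_ _ id _]] := approx 1 ltr01.
  have iPsi := hintegrable_sqr_approx (tphi k) mPsi id.
  apply: (hintegrable_le mwP (hintegrableZ Cw iPsi)) => x Bx.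
  rewrite ger0_norm; last by rewrite mulr_ge0// sqr_ge0.
  by apply: ler_wpM2r; [exact: sqr_ge0|exact: wC].
rewrite (hintegralE iwP) lee_fin; apply/ler_addgt0Pr => e e0.
(* Chosen so that, with tolerance [e / c], all errors add up to exactly [(c - 1) * (e / c) <= e];
   the summand 1 also makes [c] positive. *)
pose c := 2 * (P + Q) / gam + 2 * Cw + 1.
have c0 : 0 < c.
  apply: ltr_wpDl => //; apply: addr_ge0; last exact: mulr_ge0.
  by apply: divr_ge0; [apply: mulr_ge0 => //; exact: addr_ge0|exact: ltW].
have [k _ /(_ k (leqnn k)) [iD De id de]] := approx (e / c) (divr_gt0 e0 c0).
have step := energy_step (ltnW n1) t0 t1 K0 mum Cw_ wC hw mV V0 VC abs mPsi mG
  weak iPV (tphi k) iD id.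
have iu := hintegrable_sqr_test (test_functionM Cw_ (tphi k)).
have split : hRint (fun x => w x ^+ 2 * Psi x ^+ 2) <=
    2 * hRint (fun x => (w x * phi_ k x) ^+ 2) +
    2 * Cw * hRint (fun x => (phi_ k x - Psi x) ^+ 2).
  apply: (hRint_le_lin iwP iu id) => x Bx.
  have := ler_wpM2r (sqr_ge0 (phi_ k x - Psi x)) (wC x Bx).
  move: (w x) (phi_ k x) (Psi x); clear=> a f p h.
  have : 0 <= (a * (2 * f - p)) ^+ 2 by exact: sqr_ge0.
  by lra.
have I0 : 0 <= hRint (fun x => (w x * phi_ k x) ^+ 2).
  by apply: hRint_ge0 => x _; exact: sqr_ge0.
rewrite norm1' -/P -/Q in step.
move: De de step split I0.
move: (hRint (fun x => w x ^+ 2 * Psi x ^+ 2)) (hRint (fun x => (w x * phi_ k x) ^+ 2))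
  (hRint (fun x => (phi_ k x - Psi x) ^+ 2)) (hRint _) => J I E D De de step split I0.
have gI : gam * I <= 2 * K + (P + Q) * (e / c).
  apply: le_trans (ler_wpM2r I0 gamP) _; apply: le_trans step _.
  rewrite mulr1 -addrA lerD2l [leRHS]mulrDl.
  by apply: lerD; exact: ler_wpM2l.
have II : I <= (2 * K + (P + Q) * (e / c)) / gam by rewrite ler_pdivlMr// mulrC.
have ec : 0 <= e / c by apply: divr_ge0; exact: ltW.
apply: (le_trans split).
apply: (@le_trans _ _ (2 * ((2 * K + (P + Q) * (e / c)) / gam) + 2 * Cw * (e / c))).
  by apply: lerD; apply: ler_wpM2l => //; exact: mulr_ge0.
rewrite [leLHS](_ : _ = 4 * K / gam + (c - 1) * (e / c)).
  by rewrite lerD2l mulrBl mul1r mulrCA divff ?gt_eqF// mulr1 gerBl.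
by move: (e / c) => s; rewrite /c; field; rewrite gt_eqF.
Qed.

End energy_limit.

(** * The estimate for two bumps and the choice of the constants *)

Lemma hmeasurable_powR (R : realType) (n : nat) (f : 'rV[R]_n -> R) (a : R) :
  hmeasurable f -> hmeasurable (fun x => f x `^ a).
Proof. by move=> mf; exact: (measurableT_comp (measurable_powR a) mf). Qed.

Section e1_axis.
Context (R : realType) (n : nat).

Lemma e1_axis_ball (a : R) : -1 < a < 1 -> @poincare_ball R n (e1_axis n a).
Proof.
move=> /andP[a1 a2]; have : a ^+ 2 < 1.
  by rewrite -real_normK ?num_real// expr_lt1// ltr_norml a1.
apply: le_lt_trans; rewrite /sqn /dotr; case: n => [|m].
  by rewrite big_ord0 sqr_ge0.
rewrite big_ord_recl big1 ?addr0 => [|i _]; rewrite !mxE /=; last by rewrite mul0r.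
by rewrite mulr1n -expr2.
Qed.

End e1_axis.

Section two_bumps.
Context (R : realType) (n : nat).
Local Notation mR := (measurableTypeR R).
Local Notation B := (@poincare_ball R n).
Implicit Types (x z : 'rV[R]_n).

(** The bumps enter only through [c], [C] and [kappa], and the absorption constant [K] is an
    argument given independently of the centres; this is what makes the bound uniform in their
    position. The factor 2 in [2 * C] counts the bumps, and the exponent [kappa / 2] appears because
    [s] stands for [sech_sqr + dl], which dominates the square of each [sech_dist]. *)
Lemma two_bump_estimate (lambda mu m p kappa t beta eta K c C gam : R)
    (U1 U2 Psi : 'rV[R]_n -> R) z1 z2 :
  (1 < n)%N -> 0 < t -> t < 1 -> 0 < beta -> 0 < kappa -> 0 <= K -> mu <= m ->
  1 < p -> 0 < c -> 0 < C -> 0 < gam ->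
  gam <= (1 - t) * ((n%:R - 1) / 2) ^+ 2 - (lambda + t + eta + (1 + t) * beta ^+ 2) ->
  (forall s W, 0 < s -> 0 < W -> W <= (2 * C) * s `^ (kappa / 2) ->
    m * (W `^ (p - 1) * s `^ (- beta)) <= eta * s `^ (- beta) + K * W `^ (p - 1)) ->
  B z1 -> B z2 -> hmeasurable U1 -> hmeasurable U2 ->
  (forall x, B x -> c * expR (- (kappa * hdist x z1)) <= U1 x /\
    U1 x <= C * expR (- (kappa * hdist x z1))) ->
  (forall x, B x -> c * expR (- (kappa * hdist x z2)) <= U2 x /\
    U2 x <= C * expR (- (kappa * hdist x z2))) ->
  H1_solution lambda (fun x => mu * (U1 x + U2 x) `^ (p - 1) * Psi x) Psi ->
  hintegral (fun x => Psi x ^+ 2 * (U1 x + U2 x) `^ (p - 1)) = 1%E ->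
  (hintegral (fun x => (Psi x ^+ 2 / (U1 x + U2 x) `^ (2 * (beta / kappa)))%R) <=
    ((8 * c^-1 `^ (2 / kappa)) `^ beta * (4 * K / gam))%:E)%E.
Proof.
move=> n1 t0 t1 b0 k0 K0 mum p1 c0 C0 gam0 gamP absorb B1 B2 mU1 mU2 hU1 hU2 sol norm1.
pose W x := U1 x + U2 x.
have k0' := ltW k0; have C0' := ltW C0; have c0' := ltW c0.
have lower z (U : 'rV[R]_n -> R) x : B z -> B x ->
    c * expR (- (kappa * hdist x z)) <= U x -> c * (sech_dist z x / 2) `^ kappa <= U x.
  move=> Bz Bx; apply: le_trans; apply: ler_wpM2l => //.
  by have /andP[] := expR_hdist_bounds k0 Bz Bx.
have upper z (U : 'rV[R]_n -> R) x : B z -> B x ->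
    U x <= C * expR (- (kappa * hdist x z)) -> U x <= C * sech_dist z x `^ kappa.
  move=> Bz Bx /le_trans; apply; apply: ler_wpM2l => //.
  by have /andP[] := expR_hdist_bounds k0 Bz Bx.
have pos z (U : 'rV[R]_n -> R) x :
    c * expR (- (kappa * hdist x z)) <= U x -> 0 < U x.
  by apply: lt_le_trans; rewrite mulr_gt0// expR_gt0.
have U1_gt0 x : B x -> 0 < U1 x by move=> Bx; apply: (pos z1); case: (hU1 x Bx).
have U2_gt0 x : B x -> 0 < U2 x by move=> Bx; apply: (pos z2); case: (hU2 x Bx).
have W_gt0 x : B x -> 0 < W x by move=> Bx; rewrite addr_gt0 ?U1_gt0 ?U2_gt0.
have WC x : B x -> W x <= 2 * C.
  move=> Bx; have aux z (U : 'rV[R]_n -> R) : B z ->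
      U x <= C * expR (- (kappa * hdist x z)) -> U x <= C.
    move=> Bz /(upper _ _ _ Bz Bx)/le_trans; apply.
    rewrite -[leRHS](_ : C * 1 `^ kappa = C); last by rewrite powR1 mulr1.
    apply: ler_wpM2l => //.
    have q0 := sech_dist_gt0 Bz Bx.
    apply: ge0_ler_powR => //; last exact: sech_dist_le1.
      by rewrite nnegrE ltW.
    by rewrite nnegrE.
  rewrite mulr_natl mulr2n; apply: lerD; first by apply: (aux z1) => //; case: (hU1 x Bx).
  by apply: (aux z2) => //; case: (hU2 x Bx).
have mV : hmeasurable (fun x => W x `^ (p - 1)).
  by apply: hmeasurable_powR; exact: measurable_funD.
have VC x : B x -> W x `^ (p - 1) <= (2 * C) `^ (p - 1).
  move=> Bx; apply: ge0_ler_powR; last exact: WC.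
  - by rewrite subr_ge0 ltW.
  - by rewrite nnegrE ltW// W_gt0.
  - by rewrite nnegrE mulr_ge0.
have WS dl x : 0 < dl -> B x ->
    W x <= 2 * C * (sech_sqr z1 z2 x + dl) `^ (kappa / 2).
  move=> dl0 Bx; have S0 := sech_sqr_ge0 z1 z2 x.
  have aux z (U : 'rV[R]_n -> R) : B z -> sech_dist z x ^+ 2 <= sech_sqr z1 z2 x ->
      U x <= C * expR (- (kappa * hdist x z)) ->
      U x <= C * (sech_sqr z1 z2 x + dl) `^ (kappa / 2).
    move=> Bz qS /(upper _ _ _ Bz Bx)/le_trans; apply; apply: ler_wpM2l => //.
    have q0 := ltW (sech_dist_gt0 Bz Bx).
    rewrite (_ : sech_dist z x `^ kappa = (sech_dist z x ^+ 2) `^ (kappa / 2)).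
      apply: ge0_ler_powR; rewrite ?nnegrE ?sqr_ge0//; first exact: divr_ge0.
        by rewrite addr_ge0// ltW.
      by rewrite (le_trans qS)// lerDl ltW.
    rewrite -powR_mulrn// -powRrM; congr (_ `^ _).
    by field.
  rewrite -mulrA mulr_natl mulr2n; apply: lerD.
    by apply: (aux z1) => //; [rewrite lerDl sqr_ge0|case: (hU1 x Bx)].
  by apply: (aux z2) => //; [rewrite lerDr sqr_ge0|case: (hU2 x Bx)].
have bound dl : 0 < dl ->
    (hintegral (fun x => (weight z1 z2 beta dl x ^+ 2 * Psi x ^+ 2)%R) <=
     (4 * K / gam)%:E)%E.
  move=> dl0.
  apply: (@energy_estimate _ _ lambda mu m t beta eta K ((2 * C) `^ (p - 1))
    ((dl `^ (- (beta / 2))) ^+ 2) gam _ (fun x => W x `^ (p - 1))) => //.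
  - exact: powR_ge0.
  - exact: sqr_ge0.
  - exact: smooth_weight.
  - move=> x Bx; rewrite ler_sqr ?nnegrE ?weight_ge0 ?powR_ge0//.
    exact: weight_le.
  - by move=> x Bx; exact: hgrad_weight_le.
  - by move=> x Bx; exact: powR_ge0.
  - move=> x Bx; rewrite weight_sqr; apply: absorb.
    + by rewrite ltr_wpDl// sech_sqr_ge0.
    + exact: W_gt0.
    + exact: WS.
have [G [mPsi _ _] _] := sol.
have mS : hmeasurable (fun x => sech_sqr z1 z2 x `^ (- beta) * Psi x ^+ 2).
  apply: measurable_funM; last exact: measurable_funX.
  apply: hmeasurable_powR.
  by apply: hmeasurable_smooth; exact: smooth_sech_sqr.
have S_ge0 x : 0 <= sech_sqr z1 z2 x `^ (- beta) * Psi x ^+ 2.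
  by rewrite mulr_ge0 ?powR_ge0 ?sqr_ge0.
have boundS :
    (hintegral (fun x => (sech_sqr z1 z2 x `^ (- beta) * Psi x ^+ 2)%R) <=
     (4 * K / gam)%:E)%E.
  apply: (hintegral_fatou_bound (f_ := fun k x =>
    weight z1 z2 beta k.+1%:R^-1 x ^+ 2 * Psi x ^+ 2)) => //.
  - move=> k; apply: measurable_funM; apply: measurable_funX => //.
    by apply: hmeasurable_smooth; apply: smooth_weight => //; rewrite invr_gt0.
  - by move=> k x _; rewrite mulr_ge0 ?sqr_ge0.
  (* In the ball [sech_sqr] is positive, so the negative power is continuous at the limit and
     convergence holds at every point. *)
  - apply: aeW => x Bx; apply: cvgM; last exact: cvg_cst.
    under eq_cvg do rewrite weight_sqr.
    have S0 := sech_sqr_gt0 z2 B1 Bx.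
    have cS : {for sech_sqr z1 z2 x, continuous (fun s : R => s `^ (- beta))}.
      apply: differentiable_continuous; apply/derivable1_diffP.
      by apply: derivable_powR; rewrite in_itv/= S0.
    have cT : sech_sqr z1 z2 x + k.+1%:R^-1 @[k --> \oo] --> sech_sqr z1 z2 x + 0.
      by apply: cvgD; [exact: cvg_cst|exact: cvg_harmonic].
    rewrite addr0 in cT; exact: (cvg_comp _ _ cT cS).
  - by apply: nearW => k; apply: bound; rewrite invr_gt0.
have iS : hintegrable (fun x => sech_sqr z1 z2 x `^ (- beta) * Psi x ^+ 2).
  by apply: ge0_hintegrable => //; exact: le_lt_trans boundS (ltry _).
set A := (8 * c^-1 `^ (2 / kappa)) `^ beta.
have A0 : 0 <= A by exact: powR_ge0.
apply: (@le_trans _ _ (hintegral (fun x =>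
    A * (sech_sqr z1 z2 x `^ (- beta) * Psi x ^+ 2)))).
  apply: ge0_le_hintegral.
  - apply: measurable_funM; first exact: measurable_funX.
    under eq_fun do rewrite -powRN.
    by apply: hmeasurable_powR; exact: measurable_funD.
  - exact: measurable_funM.
  - by move=> x _; rewrite divr_ge0 ?sqr_ge0 ?powR_ge0.
  - move=> x Bx; rewrite [leLHS]mulrC [leRHS]mulrA; apply: ler_wpM2r; first exact: sqr_ge0.
    apply: weight_inv_bound => //; try exact: sech_dist_gt0.
      apply: (@le_trans _ _ (U1 x)); last by rewrite lerDl ltW// U2_gt0.
      by apply: lower => //; case: (hU1 x Bx).
    apply: (@le_trans _ _ (U2 x)); last by rewrite lerDr ltW// U1_gt0.
    by apply: lower => //; case: (hU2 x Bx).
rewrite (hintegralE (hintegrableZ A iS)) lee_fin (hRintZ A iS).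
by apply: ler_wpM2l => //; rewrite -lee_fin -(hintegralE iS).
Qed.

End two_bumps.

Theorem proposition9p1 (R : realType) (n : nat) (p lambda : R) (u : R -> R)
    (eps : R) :
  (3 <= n)%N -> 1 < p -> p <= 2 ->
  (p < (n%:R + 2) / (n%:R - 2) /\ lambda < (n%:R - 1) ^+ 2 / 4) \/
  [/\ (4 <= n)%N, p = (n%:R + 2) / (n%:R - 2),
      n%:R * (n%:R - 2) / 4 < lambda & lambda < (n%:R - 1) ^+ 2 / 4] ->
  ground_state n lambda p u ->
  (* the known two-sided bound on the translates of the ground state *)
  (exists c C : R, [/\ 0 < c, 0 < C &
    forall z x : 'rV[R]_n, poincare_ball z -> poincare_ball x ->
      c * expR (- (decay_rate n lambda * hdist x z)) <= translate u z x /\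
      translate u z x <= C * expR (- (decay_rate n lambda * hdist x z))]) ->
  0 < eps -> eps < 1 ->
  exists2 alpha : R, 0 < alpha &
  exists M : R, \forall r \near 1^'-,
    let W : 'rV[R]_n -> R := fun x =>
      translate u (e1_axis n (- r)) x + translate u (e1_axis n r) x in
    forall (mu : R) (Psi : 'rV[R]_n -> R),
      mu < p / (1 - eps) ->
      H1_solution lambda (fun x => mu * W x `^ (p - 1) * Psi x) Psi ->
      hintegral (fun x => Psi x ^+ 2 * W x `^ (p - 1)) = 1%E ->
      (hintegral (fun x => (Psi x ^+ 2 / W x `^ (2 * alpha))%R) <= M%:E)%E.
Proof.
move=> n3 p1 p2 cases [cu _ _ _] [c [C [c0 C0 uP]]] eps0 eps1.
set kappa := decay_rate n lambda in uP.
have n1 : 1 < n%:R :> R by rewrite ltr1n (leq_trans _ n3).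
have kappa0 : 0 < kappa.
  by rewrite divr_gt0// ltr_wpDr ?sqrtr_ge0// subr_gt0.
pose L : R := ((n%:R - 1) / 2) ^+ 2.
pose g := L - lambda.
have L0 : 0 <= L by exact: sqr_ge0.
have g0 : 0 < g.
  rewrite subr_gt0 /L expr_div_n (_ : 2 ^+ 2 = 4 :> R) -?natrX//.
  by case: cases => [[]|[]].
(* [t] is both the Young parameter and the exponent [beta]. The gap [g] is shared out: g/4 to [eta],
   at most g/4 to [t * (L + 1)], at most g/8 to [(1 + t) * t ^+ 2]. At least 3g/8 is left for
   [gam]. *)
pose t := g / (4 * (g + L + 1)).
have D0 : 0 < g + L + 1 by rewrite ltr_wpDl// addr_ge0// ltW.
have tE : t * (g + L + 1) = g / 4.
  by rewrite /t; field; rewrite gt_eqF.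
have t0 : 0 < t by rewrite divr_gt0// mulr_gt0.
have t4 : 4 * t < 1 by nra.
have tL : t * (L + 1) <= g / 4 by nra.
have tg : t <= g / 4 by nra.
pose eta := g / 4.
pose gam := (1 - t) * L - (lambda + t + eta + (1 + t) * t ^+ 2).
have gam0 : 0 < gam.
  have : (1 + t) * t ^+ 2 <= g / 8 by nra.
  by rewrite /gam /eta /g in g0 tL tg *; lra.
(* Absorbing with the upper bound [m] in place of [mu] fixes [K] before [r], [mu] and [Psi] are
   introduced. *)
pose m := p / (1 - eps).
have m0 : 0 < m by rewrite divr_gt0 ?subr_gt0// (lt_trans ltr01).
have [K K0 absorb] := @potential_absorption R (2 * C) kappa t p m eta
  (mulr_gt0 (ltr0n R 2) C0) kappa0 t0 p1 m0 (divr_gt0 g0 (ltr0n R 4)).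
exists (t / kappa); first by rewrite divr_gt0.
exists ((8 * c^-1 `^ (2 / kappa)) `^ t * (4 * K / gam)).
near=> r => mu Psi mum sol norm1.
have r0 : 0 < r by near: r; exact: nbhs_left_gt.
have r1 : r < 1 by near: r; exact: nbhs_left_lt.
have Bm : poincare_ball (e1_axis n (- r)) by apply: e1_axis_ball; lra.
have Bp : poincare_ball (e1_axis n r) by apply: e1_axis_ball; lra.
apply: (@two_bump_estimate _ _ lambda mu m p kappa t t eta K c C gam _ _ _
  (e1_axis n (- r)) (e1_axis n r)) => //.
- exact: leq_trans n3.
- by lra.
- exact: ltW.
- exact: measurable_translate.
- exact: measurable_translate.
- by move=> x Bx; exact: uP.
- by move=> x Bx; exact: uP.
Unshelve. all: by end_near. Qed.
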